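(* Let $(A,\mathrm{d},\mu)$ be a proper, $D$-Ahlfors regular metric space, with a dyadic decomposition $\mathcal{D}$. Let $0<s<D$. Let $\mathcal{F}^s$ be a collection of $G_\delta$ subsets of $A$. The following are equivalent. (1) For each $E\in\mathcal{F}^s$, each $0\leq t<s$ and each $Q\in\mathcal{D}$, it holds that $$\mathcal{H}_\infty^t(E\cap Q)\geq c_{t,E}\,\mathcal{H}_\infty^t(Q),$$ for some $c_{t,E}>0$ (depending on $t$ and $E$). (2) For each countable collection $\{E_i\}_i\subset\mathcal{F}^s$, each $0<t<s$ and each open $U\subset A$ such that $U$ has a Whitney decomposition, $$\hat{\mathcal{H}}_\infty^t\Big(\bigcap_i E_i\cap U\Big)=\hat{\mathcal{H}}_\infty^t(U).$$
   Context: $(A,\mathrm d,\mu)$ is $D$-Ahlfors regular if there is $C\ge1$ with $\frac1Cr^D\le\mu(B(x,r))\le Cr^D$ for all $x\in A$, $0<r<\mathrm{diam}(A)$. $\mathcal H^t_\infty(E)=\inf\{\sum_i\mathrm{diam}(E_i)^t:E\subset\bigcup_iE_i\}$ is the $t$-Hausdorff content, and $$\hat{\mathcal H}^t_\infty(F):=\limsup_{s\downarrow t}\mathcal H^s_\infty(F),\qquad F\subset A.$$ Dyadic decomposition of a metric space $Y$: a countable collection $\mathcal D$ of subsets $Q_i$ of $Y$ such that there are constants $a,b,C\ge1$, $n_0\in\mathbb N$ and a decomposition $\mathcal D=\bigcup_n\mathcal W_n$ with: (i) for each $n\in\mathbb N$, $\#\mathcal W_n<\infty$ and $Y=\bigcup_{Q\in\mathcal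 W_n}Q$, and $\lim_n\max\{\mathrm{diam}(Q):Q\in\mathcal W_n\}=0$; (ii) for each $Q\in\mathcal D$ there is $x\in Q$ with $B(x,\mathrm{diam}(Q)/a)\subset Q\subset B(x,a\,\mathrm{diam}(Q))$; (iii) for each $n\ge n_0$ and $Q\in\mathcal W_n$ there is $Q'\in\mathcal W_{n-n_0}$ with $Q\subset Q'$; (iv) for $n\in\mathbb N$, $l\in\mathbb N\cup\{0\}$ and $Q\in\mathcal W_n$, $\#\{Q'\in\mathcal W_{n+l}:Q'\cap Q\ne\emptyset\}\le b^l$; (v) for $n\in\mathbb N$, $Q\in\mathcal W_n$, $Q'\in\mathcal W_{n+1}$, $\frac1C\mathrm{diam}(Q')\le\mathrm{diam}(Q)\le C\,\mathrm{diam}(Q')$. Whitney decomposition of an open set $U\subsetneq A$: a subcollection $\mathcal W$ of $\mathcal D$ covering $U$ by subsets of $U$ such that (i) for each $Q\in\mathcal W$ there is $x\in Q$ such that $Q'\in\mathcal W$ and $x\in Q'$ imply $Q'=Q$; (ii) there are constants $\kappa,\lambda>1$ with $\mathrm{diam}(Q)\le\frac1\kappa\mathrm{dist}(Q,\partial U)\le\lambda\,\mathrm{diam}(Q)$ for all $Q\in\mathcal W$. *)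

(* Defs.v *)
From HB Require Import structures.
From mathcomp Require Import all_boot all_order all_algebra.
From mathcomp Require Import finmap all_classical all_reals all_analysis.
From mathcomp Require Import borel_hierarchy.

Set Implicit Arguments.
Unset Strict Implicit.
Unset Printing Implicit Defensive.
Import Order.TTheory GRing.Theory Num.Theory.
Import numFieldNormedType.Exports.

Local Open Scope classical_set_scope.
Local Open Scope ring_scope.

(* The measurable types of the library are pointed; only nonemptiness of the
   space matters. *)
#[short(type="pointedMetricType")]
HB.structure Definition PointedMetric (R : numDomainType) :=
  {T of Metric R T & Pointed T}.

Section metric_notions.
Context {R : realType} {A : metricType R}.
Implicit Types (E F Q U : set A) (D W : set (set A)) (t : R).

(* The point 0 is adjoined so that the diameter of the empty set is 0. *)
Definition diameter E : \bar R :=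
  ereal_sup (0%E |` [set (mdist p.1 p.2)%:E | p in E `*` E]).

(* The distance to the empty set is +oo. *)
Definition set_dist E F : \bar R :=
  ereal_inf [set (mdist p.1 p.2)%:E | p in E `*` F].

Definition frontier E : set A := closure E `\` interior E.

Definition proper_metric : Prop :=
  forall (x : A) (r : R), compact [set y | mdist x y <= r].

(* diam(E)^t with the conventions of Hausdorff contents: 0^0 = 1 for nonempty E,
   but the empty set contributes 0 for every t, including t = 0. *)
Definition diam_pow t E : \bar R :=
  if E == set0 then 0%E else poweR (diameter E) t.

(* Finite covers are included, as sequences that are eventually empty. *)
Definition hausdorff_content t E : \bar R :=
  ereal_inf [set (\sum_(0 <= i <oo) diam_pow t (G i))%E |
             G in [set G : (set A)^nat | E `<=` \bigcup_i G i]].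

Definition hausdorff_content_hat t E : \bar R :=
  limf_esup (fun r : R => hausdorff_content r E) (t^'+).

(* The space is a finite union of sets of finite diameter, hence bounded, so
   fine does not lose information. *)
Definition dyadic_decomposition D : Prop :=
  countable D /\
  exists (a b C : R) (n0 : nat) (W : nat -> set (set A)),
    [/\ 1 <= a, 1 <= b, 1 <= C, (0 < n0)%N & D = \bigcup_n W n] /\
    [/\ (forall n, finite_set (W n) /\ \bigcup_(Q in W n) Q = setT) /\
        ereal_sup [set diameter Q | Q in W n] @[n --> \oo] --> 0%E,
        forall Q, D Q -> exists x, [/\ Q x,
          ball x (fine (diameter Q) / a) `<=` Q &
          Q `<=` ball x (a * fine (diameter Q))],
        forall n, (n0 <= n)%N -> forall Q, W n Q ->
          exists2 Q', W (n - n0)%N Q' & Q `<=` Q',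
        forall n l Q, W n Q ->
          #|` fset_set [set Q' | W (n + l)%N Q' /\ Q' `&` Q !=set0]|%:R
            <= b ^+ l &
        forall n Q Q', W n Q -> W n.+1 Q' ->
          ((C^-1)%:E * diameter Q' <= diameter Q <= C%:E * diameter Q')%E].

Definition whitney_decomposition D U W : Prop :=
  [/\ open U, U != setT, W `<=` D & \bigcup_(Q in W) Q = U] /\
  (forall Q, W Q ->
     exists2 x, Q x & forall Q', W Q' -> Q' x -> Q' = Q) /\
  (exists kappa lambda : R, [/\ 1 < kappa, 1 < lambda &
     forall Q, W Q ->
       (diameter Q <= (kappa^-1)%:E * set_dist Q (frontier U) <=
        lambda%:E * diameter Q)%E]).

End metric_notions.

Arguments proper_metric {R} A.

Notation borelType A := (g_sigma_algebraType (@open A)).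

Definition ahlfors_regular (R : realType) (A : pointedMetricType R) (D : R)
    (mu : set A -> \bar R) : Prop :=
  exists2 C : R, 1 <= C & forall (x : A) (r : R),
    0 < r -> (r%:E < diameter [set: A])%E ->
    ((C^-1 * r `^ D)%:E <= mu (ball x r) <= (C * r `^ D)%:E)%E.

(* Main.v *)
Require Import Defs.
From mathcomp Require Import all_boot all_order all_algebra.
From mathcomp Require Import all_classical all_reals all_analysis.
From mathcomp Require Import borel_hierarchy.
From mathcomp Require Import lra ring.
Import Order.TTheory GRing.Theory Num.Theory.
Import numFieldNormedType.Exports.

(** The proof rests on two facts about thick sets in a compact Ahlfors regular
    space and on a construction of open sets with Whitney decompositions.
    Below, H^t is the Hausdorff content, B a ball of radius rho, and a set E
    is called thick at the exponent r if H^r(E n B) >= c rho^r for all small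
    balls B, for some constant c > 0.

    A lower exponent erases the constant ([thick_full_content]): if E is thick
    at r and 0 < t < r, then H^t(E n V) = H^t(V) for every open V. Take closed
    sets H_i of widths h_i that cover E n V. Near a point of V that no H_i
    contains, only sets H_i much smaller than the ball B meet a small ball B,
    except near points that lie in the enlargements of infinitely many H_i;
    these have content 0. Thickness gives c rho^r <= sum of h_i^r over the H_i
    meeting B, that is, rho^t <= (1/c) sum of h_i^t (h_i/rho)^(r-t). Summed
    over the balls of nets of all dyadic scales, each H_i meets boundedly many
    balls per scale and the factors (h_i/rho)^(r-t) form a geometric series
    over the scales, so such balls cost together at most an arbitrarily small
    multiple of the sum of h_i^t. Adding them to the H_i turns the cover of E
    n V into a cover of V ([content_le_of_fat_uncovered]).

    Countable intersections stay thick ([thick_bigcap]): let the open sets O_j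
    be thick at every exponent below s. Fix exponents t = t_0 < t_1 < ... < s.
    If a cover of the intersection of all O_j with a ball were too cheap at
    the exponent t, one finds nested balls B_j of radii rho_j, with the
    closure of B_(j+1) inside O_j, such that the sum of h_i^(t_j) over the H_i
    meeting B_j is less than c_j rho_j^(t_j) with c_j <= 1. The step from j to
    j+1 is the covering estimate of the first fact, and it uses the thickness
    of O_j only with its own constant; the slack t_j < t_(j+1) absorbs that
    constant. A point common to the B_j lies in some H_i, which then meets
    every B_j, so that h_i < rho_j for all j, although h_i > 0 and rho_j tends
    to 0. Both facts together give the first implication: density in the cells
    is thickness, a G_delta set is an intersection of open sets that contain
    it, and equality of the contents at all exponents in (t, s) gives equality
    of the upper limits.

    Conversely, every cell Q contains a ball of comparable radius, and from
    that ball one removes a countable set which accumulates only at the edge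
    of the ball and has a point within distance rho - d(x_0, y) of every point
    y of the ball, x_0 being the centre ([punctured_ball]). What remains is an
    open set U, of the same content as the ball, each of whose points is as
    far from the frontier as from the complement; that is what the existence
    of a Whitney decomposition takes ([whitney_exists]). Equality of the upper
    limits of content for U and for E n U, the bound H^r(ball) >= c rho^r that
    comes from the measure ([content_ball_ge]), and H^r(E n Q) <=
    diam(Q)^(r-t) H^t(E n Q) yield the density of E in Q, with constants
    independent of Q. *)

Local Open Scope classical_set_scope.
Local Open Scope ring_scope.

Set Implicit Arguments.
Unset Strict Implicit.
Unset Printing Implicit Defensive.

(** * Hausdorff contents and their covers *)

Section hausdorff_content.
Context {R : realType} {A : pointedMetricType R}.
Implicit Types (t h : R) (E F : set A).

Lemma diam_pow_ge0 t E : (0 <= diam_pow t E)%E.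
Proof. by rewrite /diam_pow; case: ifP => // _; exact: poweR_ge0. Qed.

Lemma diam_pow0 t : diam_pow t (@set0 A) = 0%E.
Proof. by rewrite /diam_pow eqxx. Qed.

(** The content is the outer measure extending [diam_pow], once every set is
    declared measurable; countable subadditivity then comes from the general
    theory of outer measures. *)
Lemma hausdorff_contentE t :
  @hausdorff_content R A t =
  @mu_ext _ (g_sigma_algebraType [set: set A]) R (diam_pow t).
Proof.
apply/funext => E; congr ereal_inf; apply/seteqP; split => x /= [G].
- move=> EG <-; exists G => //; split => // n.
  exact: sub_gen_smallest.
- by move=> [_ EG] <-; exists G.
Qed.

Lemma hausdorff_content_ge0 t E : (0 <= hausdorff_content t E)%E.
Proof. by rewrite hausdorff_contentE; apply: mu_ext_ge0; exact: diam_pow_ge0. Qed.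

Lemma hausdorff_content_mono t E F :
  E `<=` F -> (hausdorff_content t E <= hausdorff_content t F)%E.
Proof. by move=> EF; rewrite hausdorff_contentE; exact: le_mu_ext. Qed.

Lemma hausdorff_content0 t : hausdorff_content t (@set0 A) = 0%E.
Proof.
by rewrite hausdorff_contentE mu_ext0 //; [exact: diam_pow0|exact: diam_pow_ge0].
Qed.

Lemma hausdorff_content_bigcup t (F : nat -> set A) :
  (hausdorff_content t (\bigcup_n F n) <= \sum_(n <oo) hausdorff_content t (F n))%E.
Proof.
rewrite hausdorff_contentE; apply: mu_ext_sigma_subadditive.
exact: diam_pow_ge0.
Qed.

Lemma hausdorff_contentU t E F : (hausdorff_content t (E `|` F) <=
  hausdorff_content t E + hausdorff_content t F)%E.
Proof.
rewrite -bigcup2E; apply: le_trans (hausdorff_content_bigcup _ _) _.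
rewrite (nneseries_split 0 2) => [|k _]; last exact: hausdorff_content_ge0.
rewrite add0n eseries0 => [|[|[|i]]//= *]; last by rewrite hausdorff_content0.
by rewrite adde0 big_mkord !big_ord_recl/= big_ord0 adde0.
Qed.

Lemma hausdorff_content_seq t (T : eqType) (s : seq T) (P : pred T)
    (F : T -> set A) :
  (hausdorff_content t [set y | exists z, [/\ z \in s, P z & F z y]] <=
   \sum_(z <- s | P z) hausdorff_content t (F z))%E.
Proof.
elim: s => [|z s IH].
  rewrite big_nil (_ : mkset _ = set0) ?hausdorff_content0//.
  by rewrite -subset0 => y [z []].
set E' := mkset _ in IH.
rewrite big_cons; case: ifPn => Pz.
  apply: (@le_trans _ _ (hausdorff_content t (F z `|` E'))).
    apply: hausdorff_content_mono => y [w []]; rewrite inE => /orP[/eqP ->|ws] Pw Fw.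
      by left.
    by right; exists w.
  by apply: le_trans (hausdorff_contentU _ _ _) _; rewrite leeD2l.
apply: le_trans IH; apply: hausdorff_content_mono => y [w []].
rewrite inE => /orP[/eqP ->|ws] Pw Fw; first by rewrite Pw in Pz.
by exists w.
Qed.

Definition width_le h E := forall x y, E x -> E y -> mdist x y <= h.

Lemma width_leP h E : 0 <= h -> width_le h E <-> (diameter E <= h%:E)%E.
Proof.
move=> h0; split=> [wE|dE x y Ex Ey].
  apply: ge_ereal_sup => _ /= [->|[[x y] /= [Ex Ey] <-]]; rewrite lee_fin//.
  exact: wE.
rewrite -lee_fin; apply: le_trans dE; apply: ereal_sup_ubound; right.
by exists (x, y).
Qed.

Lemma diameter_ge0 E : (0 <= diameter E)%E.
Proof. by apply: ereal_sup_ubound; left. Qed.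

Lemma diam_pow_pos t E : 0 < t -> diam_pow t E = poweR (diameter E) t.
Proof.
move=> t0; rewrite /diam_pow; case: eqP => // ->.
have -> : diameter (@set0 A) = 0%E.
  apply/eqP; rewrite eq_le diameter_ge0 andbT.
  by apply/(width_leP _ (lexx _)) => x y [].
by rewrite poweR0r// gt_eqF.
Qed.

Lemma diam_pow_le t h E : 0 < t -> 0 <= h -> width_le h E ->
  (diam_pow t E <= (h `^ t)%:E)%E.
Proof.
move=> t0 h0 /(width_leP _ h0) wE; rewrite diam_pow_pos// -poweR_EFin.
apply: gt0_ler_poweR => //; rewrite ?(ltW t0)// in_itv/= ?diameter_ge0 ?leey//.
by rewrite lee_fin h0.
Qed.

Lemma content_le_series t E (H : nat -> set A) (h : nat -> R) :
  0 < t -> (forall i, 0 <= h i) -> (forall i, width_le (h i) (H i)) ->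
  E `<=` \bigcup_i H i ->
  (hausdorff_content t E <= \sum_(i <oo) (h i `^ t)%:E)%E.
Proof.
move=> t0 h0 wH EH.
apply: (@le_trans _ _ (\sum_(0 <= i <oo) diam_pow t (H i))%E).
  by apply: ereal_inf_lbound; exists H.
by apply: lee_nneseries => // i *; [exact: diam_pow_ge0|exact: diam_pow_le].
Qed.

Lemma content_le_diam_pow t (E : set A) : (hausdorff_content t E <= diam_pow t E)%E.
Proof.
pose G n := if n == 0%N then E else set0.
apply: (@le_trans _ _ (\sum_(0 <= i <oo) diam_pow t (G i))%E).
  by apply: ereal_inf_lbound; exists G => // x Ex; exists 0%N.
rewrite (nneseries_split 0 1) => [|i _]; last exact: diam_pow_ge0.
by rewrite big_nat1 eseries0 ?adde0// => -[|i]//= _ _; exact: diam_pow0.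
Qed.

Lemma content_le_pow t h E : 0 < t -> 0 <= h -> width_le h E ->
  (hausdorff_content t E <= (h `^ t)%:E)%E.
Proof.
move=> t0 h0 wE; apply: le_trans (content_le_diam_pow t E) _.
exact: diam_pow_le.
Qed.

Lemma width_le_closure h E : width_le h E -> width_le h (closure E).
Proof.
move=> wE x y Ex Ey; apply/ler_addgt0Pl => e e0.
have e2 : 0 < e / 2 by rewrite divr_gt0.
have [x' [Ex' ]] := Ex _ (nbhsx_ballx x _ e2).
have [y' [Ey' ]] := Ey _ (nbhsx_ballx y _ e2).
rewrite !ballEmdist/= => yy' xx'.
have := wE _ _ Ex' Ey'.
have := metric_triangle x x' y; have := metric_triangle x' y' y.
rewrite (metric_sym y' y); lra.
Qed.

(** Covers can be taken closed, with strict positive bounds on their widths: the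
    closure has the same diameter, and an arbitrarily small summable increase of
    the t-th powers makes every width positive.  Positive widths remove the
    singletons, which cost nothing, as a special case. *)
Lemma content_lt_cover t E (L : \bar R) : 0 < t ->
  (hausdorff_content t E < L)%E ->
  exists (H : nat -> set A) (h : nat -> R),
  [/\ forall i, closed (H i), forall i, 0 < h i,
      forall i x y, H i x -> H i y -> mdist x y < h i,
      E `<=` \bigcup_i H i &
      (\sum_(i <oo) (h i `^ t)%:E < L)%E].
Proof.
move=> t0 /ereal_inf_lt[_ [G /= EG <-] GL].
set S := (X in (X < _)%E) in GL.
have [e e0 SeL] : exists2 e : R, 0 < e & (S + e%:E < L)%E.
  have S0 : (0 <= S)%E by apply: nneseries_ge0 => *; exact: diam_pow_ge0.
  move: S S0 GL => [s| |] //= _; case: L => [l| |]//=.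
    rewrite lte_fin => sl; exists ((l - s) / 2); first by rewrite divr_gt0 ?subr_gt0.
    by rewrite -EFinD lte_fin; lra.
  by move=> _; exists 1 => //; rewrite -EFinD ltry.
have Sfin i : (diam_pow t (G i) < +oo)%E.
  have : (S < +oo)%E by apply: lt_le_trans GL (leey _).
  apply: le_lt_trans; rewrite /S (@nneseriesD1 _ _ i)//; last first.
    by move=> *; exact: diam_pow_ge0.
  by rewrite leeDl//; apply: nneseries_ge0 => *; exact: diam_pow_ge0.
have e2 i : 0 < e / (2 ^ i.+1)%:R by rewrite divr_gt0// ltr0n expn_gt0.
pose d i : R := fine (diameter (G i)).
have dE i : diameter (G i) = (d i)%:E.
  rewrite /d fineK// ge0_fin_numE ?diameter_ge0//.
  by apply: (@lty_poweRy _ _ t); rewrite ?gt_eqF// -diam_pow_pos.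
have d0 i : 0 <= d i by rewrite -lee_fin -dE diameter_ge0.
pose h i := (d i `^ t + e / (2 ^ i.+1)%:R) `^ t^-1.
have ht i : h i `^ t = d i `^ t + e / (2 ^ i.+1)%:R.
  by rewrite /h -powRrM mulVf ?gt_eqF// powRr1// addr_ge0// ?powR_ge0// ltW.
have h0 i : 0 <= h i by exact: powR_ge0.
have dh i : d i < h i.
  rewrite ltNge; apply/negP => hd.
  have := @ge0_ler_powR _ t (ltW t0) (h i) (d i) (h0 i) (d0 i) hd.
  by rewrite ht; have := e2 i; lra.
exists (fun i => closure (G i)), h; split.
- by move=> i; exact: closed_closure.
- by move=> i; apply: le_lt_trans (dh i).
- move=> i x y Hx Hy; apply: le_lt_trans (dh i).
  apply: (width_le_closure _ Hx Hy); apply/(width_leP _ (d0 i)).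
  by rewrite dE.
- by move=> x /EG[i _ Gx]; exists i => //; exact: subset_closure.
- apply: le_lt_trans SeL.
  apply: le_trans (epsilon_trick _ _ _); last exact: ltW.
    apply: lee_nneseries => i *; first by rewrite lee_fin powR_ge0.
    by rewrite ht EFinD leeD// diam_pow_pos// dE poweR_EFin.
  by move=> n; exact: diam_pow_ge0.
Qed.

Lemma metric_ball_open (x : A) (r : R) : open (ball x r).
Proof.
rewrite openE => y; rewrite ballEmdist/= => xy; apply/nbhs_ballP.
exists (r - mdist x y); first by rewrite /= subr_gt0.
move=> z; rewrite !ballEmdist/= => yz.
by have := metric_triangle x y z; lra.
Qed.

End hausdorff_content.

(** * Balls that meet much of a cover *)

Section geometric_sums.
Context {R : realType}.

(** In an increasing geometric sequence the sum of all terms up to the last one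
    below B is a constant multiple of that term, whatever its index is. *)
Lemma sum_geometric_le (q B : R) (a : nat -> R) n : 1 < q -> 0 <= B ->
  (forall k, 0 <= a k) -> (forall k, a k.+1 = q * a k) ->
  \sum_(0 <= k < n | a k <= B) a k <= B * (q / (q - 1)).
Proof.
move=> q1 B0 a0 aS.
have q0 : 0 < q - 1 by rewrite subr_gt0.
have full m : (q - 1) * \sum_(0 <= k < m) a k <= a m.
  elim: m => [|m IH]; first by rewrite big_geq// mulr0.
  by rewrite big_nat_recr//= mulrDr aS; lra.
elim: n => [|n IH].
  by rewrite big_geq// mulr_ge0// divr_ge0 ?(ltW q0)//; lra.
have [anB|Ban] := leP (a n) B; last first.
  rewrite big_mkcond big_nat_recr//= ifF ?addr0 -?big_mkcond//.
  by apply/negbTE; rewrite -ltNge.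
apply: (@le_trans _ _ (\sum_(0 <= k < n.+1) a k)).
  by rewrite big_mkcond; apply: ler_sum => k _; case: ifP.
rewrite mulrA ler_pdivlMr// mulrC; apply: le_trans (full _) _.
by rewrite aS mulrC ler_wpM2r//; lra.
Qed.

Lemma divr_exp2_small (d e : R) : 0 < e -> exists k, d / 2 ^+ k < e.
Proof.
move=> e0; have [d0|d0] := leP d 0.
  by exists 0%N; rewrite expr0 divr1; exact: le_lt_trans d0 e0.
have ed : 0 < e / d by rewrite divr_gt0.
have [n _ nP] := @near_infty_natSinv_expn_lt R (PosNum ed).
exists n; have := nP n (leqnn _); rewrite /= ltr_pdivlMr// mulrC.
by rewrite mul1r.
Qed.

End geometric_sums.

Section heavy_balls.
Context {R : realType} {A : pointedMetricType R}.

Definition cover_mass (r : R) (H : nat -> set A) (h : nat -> R) (B : set A) :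
  \bar R :=
  (\sum_(i <oo) (if `[< H i `&` B !=set0 >] then (h i `^ r)%:E else 0))%E.

Definition bounded_nets (delta : R) (N : nat) (X : nat -> seq A) :=
  (forall k y, exists2 z, z \in X k & mdist y z < delta / 2 ^+ k) /\
  (forall k w, (count (fun z => mdist z w < 2 * (delta / 2 ^+ k))%R (X k) <= N)%N).

Context (delta : R) (N : nat) (X : nat -> seq A).
Hypothesis delta0 : 0 < delta.
Hypothesis nets : bounded_nets delta N X.

Context (t r c M : R) (H : nat -> set A) (h : nat -> R).
Hypotheses (t0 : 0 < t) (tr : t < r) (c0 : 0 < c) (M2 : 2 <= M).
Hypotheses (h0 : forall i, 0 <= h i) (Hh : forall i, width_le (h i) (H i)).

Let rho k := delta / 2 ^+ k.

Let rho0 k : 0 < rho k. Proof. by rewrite divr_gt0// exprn_gt0. Qed.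

(** The first clause excludes members of the cover that are large compared with
    the ball; it is what makes the factors (h_i/rho)^(r-t) small. *)
Definition heavy k z :=
  (forall i, H i `&` ball z (rho k) !=set0 -> M * h i < 2 * rho k) /\
  ((c * rho k `^ r)%:E <= cover_mass r H h (ball z (rho k)))%E.

Definition heavy_const := N%:R * 2 `^ t / c * (2 `^ (r - t) / (2 `^ (r - t) - 1)).

Let small i k := M * h i < 2 * rho k.
Let K := 2 `^ t / c.

Let K0 : 0 <= K. Proof. by rewrite divr_ge0 ?powR_ge0// ltW. Qed.

Let scale_sum n i :
  \sum_(0 <= k < n | small i k) (h i / rho k) `^ (r - t) <=
  (2 / M) `^ (r - t) * (2 `^ (r - t) / (2 `^ (r - t) - 1)).
Proof.
have p0 : 0 < r - t by rewrite subr_gt0.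
have M0 : 0 < M by exact: lt_le_trans M2.
pose a k := (h i / rho k) `^ (r - t).
have hr k : 0 <= h i / rho k by rewrite divr_ge0// ltW.
apply: le_trans (@sum_geometric_le _ (2 `^ (r - t)) ((2 / M) `^ (r - t)) a n _ _ _ _).
- rewrite big_mkcond [leRHS]big_mkcond /=; apply: ler_sum => k _; case: ifP => // [sk|_].
    suff -> : a k <= (2 / M) `^ (r - t) by [].
    apply: ge0_ler_powR; rewrite ?nnegrE ?(ltW p0)//.
      by rewrite divr_ge0// ltW.
    by rewrite ler_pdivrMr// mulrAC ler_pdivlMr// mulrC ltW.
  by case: ifP => // _; exact: powR_ge0.
- by have := @gt0_ltr_powR R (r - t) p0 1 2; rewrite powR1 !nnegrE ler01 ler0n ltr1n; exact.
- exact: powR_ge0.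
- by move=> k; exact: powR_ge0.
- move=> k; rewrite /a -powRM//; congr (_ `^ _).
  by rewrite /rho exprS; field; rewrite !gt_eqF// exprn_gt0.
Qed.

Let level_content k :
  (hausdorff_content t [set y | exists z,
      [/\ z \in X k, `[< heavy k z >] & ball z (rho k) y]] <=
   \sum_(i <oo) ((N%:R * K * h i `^ t)%:E *
       (if small i k then ((h i / rho k) `^ (r - t))%:E else 0)))%E.
Proof.
apply: le_trans (hausdorff_content_seq _ _ _ _) _.
pose g i z := (if `[< H i `&` ball z (rho k) !=set0 >] && small i k
               then (h i `^ r)%:E else 0)%E.
have g0 i z : (0 <= g i z)%E by rewrite /g; case: ifP => // _; rewrite lee_fin powR_ge0.
pose L := K * rho k `^ (t - r).
have L0 : 0 <= L by rewrite mulr_ge0// powR_ge0.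
apply: (@le_trans _ _ (\sum_(z <- X k | `[< heavy k z >]) \sum_(i <oo) (L%:E * g i z))%E).
  apply: lee_sum => z /asboolP[sm hv].
  apply: (@le_trans _ _ ((2 * rho k) `^ t)%:E).
    apply: content_le_pow => //; first by rewrite mulr_ge0// ltW.
    move=> x y; rewrite ballEmdist /= => zx zy.
    have := metric_triangle x z y; rewrite (metric_sym x z); lra.
  rewrite nneseriesZl => [|i _]; last exact: g0.
  have -> : (\sum_(i <oo) g i z = cover_mass r H h (ball z (rho k)))%E.
    apply: eq_eseriesr => i _; rewrite /g.
    case: ifPn => [/andP[-> //]|]; rewrite negb_and.
    by case: asboolP => //= mt /negP; rewrite /small sm.
  apply: le_trans (lee_wpmul2l _ hv); last by rewrite lee_fin.
  rewrite -EFinM lee_fin /L /K powRM//; last exact: ltW.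
  rewrite powRB ?(gt_eqF (rho0 k)) ?implybT//.
  rewrite le_eqVlt; apply/orP; left; apply/eqP.
  by field; rewrite !gt_eqF// powR_gt0.
apply: (@le_trans _ _ (\sum_(z <- X k) \sum_(i <oo) (L%:E * g i z))%E).
  rewrite big_mkcond /=; apply: lee_sum => z _; case: ifP => // _.
  by apply: nneseries_ge0 => i *; rewrite mule_ge0.
rewrite -nneseries_sum => [|z i _]; last by rewrite mule_ge0.
apply: lee_nneseries => i _.
  by move=> _; apply: sume_ge0 => z _; rewrite mule_ge0.
rewrite -ge0_sume_distrr => [|z _]; last exact: g0.
rewrite /g; case: ifPn => [sik|nik]; last first.
  by rewrite big1 ?mule0// => z _; rewrite andbF.
have ir : h i `^ r = h i `^ t * h i `^ (r - t).
  by rewrite -powRD ?subrKC// (gt_eqF (lt_trans t0 tr)).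
apply: (@le_trans _ _ (L%:E * (N%:R * h i `^ r)%:E)%E).
  apply: lee_wpmul2l => //.
  under eq_bigr do rewrite andbT.
  rewrite -big_mkcond /= sumEFin lee_fin big_const_seq iter_addr_0 -[leLHS]mulr_natl.
  rewrite ler_wpM2r ?powR_ge0// ler_nat.
  have [[w Hw]|] := pselect (H i !=set0); last first.
    move=> /set0P/negP/negPn/eqP Hi; rewrite (eq_count (a2 := pred0)) ?count_pred0//.
    by move=> z; apply/asboolP; rewrite Hi set0I => -[].
  apply: leq_trans (nets.2 k w); apply: sub_count => z /asboolP[u []].
  rewrite ballEmdist /= => Hu zu.
  have := metric_triangle z u w; have := Hh Hu Hw; move: sik zu; rewrite /small.
  rewrite -/(rho k); have := h0 i; have := M2; nra.
rewrite -!EFinM lee_fin /L ir powRM ?invr_ge0//; last exact: ltW.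
rewrite -(powR_inv1 (ltW (rho0 k))) -powRrM mulN1r opprB.
rewrite le_eqVlt; apply/orP; left; apply/eqP; ring.
Qed.

(** Since c rho^r is at most the r-cost of the members meeting the ball, rho^t is
    at most (1/c) times the sum of h_i^t (h_i/rho)^(r-t) over them.  For a fixed
    i at most N balls of each scale occur, and only scales with M h_i < 2 rho;
    over these the factors sum up to O(M^(t-r)). *)
Lemma heavy_balls_content :
  (hausdorff_content t (\bigcup_k [set y | exists z,
      [/\ z \in X k, `[< heavy k z >] & ball z (rho k) y]]) <=
   (heavy_const * (2 / M) `^ (r - t))%:E * \sum_(i <oo) (h i `^ t)%:E)%E.
Proof.
apply: le_trans (hausdorff_content_bigcup _ _) _.
apply: (le_trans (lee_nneseries _ (fun k _ => level_content k))).
  by move=> *; exact: hausdorff_content_ge0.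
have q0 i k : (0 <= if small i k then ((h i / rho k) `^ (r - t))%:E else 0)%E.
  by case: ifP => // _; rewrite lee_fin powR_ge0.
have Nh i : 0 <= N%:R * K * h i `^ t by rewrite mulr_ge0 ?powR_ge0// mulr_ge0.
rewrite nneseries_interchange => [|i j]; last by rewrite mule_ge0 ?lee_fin.
rewrite -nneseriesZl => [|i _]; last by rewrite lee_fin powR_ge0.
apply: lee_nneseries => i _.
  by move=> _; apply: nneseries_ge0 => k *; rewrite mule_ge0 ?lee_fin.
rewrite nneseriesZl; last by move=> k _; exact: q0.
set B := (2 / M) `^ (r - t) * (2 `^ (r - t) / (2 `^ (r - t) - 1)).
apply: (@le_trans _ _ ((N%:R * K * h i `^ t)%:E * B%:E)%E).
  apply: lee_wpmul2l; rewrite ?lee_fin//.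
  apply: lime_le; first by apply: is_cvg_nneseries => k *; exact: q0.
  near=> n; rewrite -big_mkcond /= sumEFin lee_fin.
  exact: scale_sum.
rewrite -!EFinM lee_fin /heavy_const /B /K.
rewrite le_eqVlt; apply/orP; left; apply/eqP; ring.
Unshelve. all: by end_near. Qed.

End heavy_balls.

(** * Completing a cover at the points it misses *)

Section fat_uncovered_points.
Context {R : realType} {A : pointedMetricType R}.
Context (delta : R) (N : nat) (X : nat -> seq A).
Hypothesis delta0 : 0 < delta.
Hypothesis nets : bounded_nets delta N X.

Lemma closed_avoid_ball (H : nat -> set A) n y : (forall i, closed (H i)) ->
  (forall i, ~ H i y) ->
  exists2 e, 0 < e & forall i, (i < n)%N -> ball y e `&` H i = set0.
Proof.
move=> cH Hy; pose F := \bigcup_(i in `I_n) H i.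
have cF : closed F by apply: closed_bigcup.
have : nbhs y (~` F).
  by apply: open_nbhs_nbhs; split; [exact: closed_openC|move=> [i _ /Hy]].
move=> /nbhs_ballP[e /= e0 eF]; exists e => // i ni.
by rewrite -subset0 => z [/eF zF Hz]; apply: zF; exists i.
Qed.

(** The condition under which a cover can be completed.  It holds for covers of
    E n V when E is thick and V is open and, in the category argument below, for
    an open V in which no small ball is light. *)
Definition fat_uncovered t c (H : nat -> set A) (h : nat -> R) (V : set A) :=
  forall y, V y -> (forall i, ~ H i y) -> exists2 e, 0 < e &
    forall z rho, 0 < rho -> rho < e -> mdist y z < rho ->
      ((c * rho `^ t)%:E <= cover_mass t H h (ball z rho))%E.

(** V is covered by the sets H_i, by enlargements of the H_i with i >= n, whose
    total cost is at most e for n large, and by the heavy balls.  Indeed, a point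
    outside the first two families has positive distance to the finitely many
    H_i with i < n, hence small balls around it meet only H_i with i >= n, and
    those are small compared with the ball because the point is not in their
    enlargement. *)
Lemma content_le_of_fat_uncovered_scale t r c M e H h V (S : R) :
  0 < t -> t < r -> 0 < c -> 2 <= M -> 0 < e ->
  (forall i, 0 <= h i) -> (forall i, width_le (h i) (H i)) ->
  (forall i, closed (H i)) -> fat_uncovered r c H h V ->
  (\sum_(i <oo) (h i `^ t)%:E = S%:E)%E ->
  (hausdorff_content t V <=
     (S + e + heavy_const N t r c * (2 / M) `^ (r - t) * S)%:E)%E.
Proof.
move=> t0 tr c0 M2 e0 h0 Hh cH fat SE.
have M0 : 0 < M by lra.
pose nbd i := [set y | exists2 w, H i w & mdist y w <= M * h i].
have ht0 i : (0 <= (h i `^ t)%:E)%E by rewrite lee_fin powR_ge0.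
pose L := (1 + 2 * M).
have L0 : 0 <= L by rewrite /L; lra.
have [n ntail] : exists n, (\sum_(n <= i <oo) (h i `^ t)%:E < (e / (L `^ t + 1))%:E)%E.
  have := @nneseries_tail_cvg _ (fun i => (h i `^ t)%:E) xpredT.
  rewrite SE ltry => /(_ isT (fun i _ => ht0 i)) tl.
  have eL : 0 < e / (L `^ t + 1) by rewrite divr_gt0// ltr_wpDl// powR_ge0.
  have : (\forall n \near \oo, (\sum_(n <= i <oo) (h i `^ t)%:E < (e / (L `^ t + 1))%:E)%E).
    move/fine_cvgP: tl => [tfin /cvgrPdist_lt/(_ _ eL) tl].
    near=> m; rewrite -[ltLHS]fineK; last by near: m; exact: tfin.
    rewrite lte_fin; apply: le_lt_trans (ler_norm _) _.
    by rewrite -normrN -sub0r; near: m.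
  by move=> [n _ /(_ n (leqnn _))]; exists n.
pose T := \bigcup_i (if (n <= i)%N then nbd i else set0).
have Tsmall : (hausdorff_content t T <= e%:E)%E.
  pose k i := if (n <= i)%N then L * h i else 0.
  apply: (@le_trans _ _ (\sum_(i <oo) (k i `^ t)%:E)%E).
    apply: (@content_le_series _ _ t T (fun i => if (n <= i)%N then nbd i else set0) k) => // i.
      by rewrite /k; case: ifP => // _; rewrite mulr_ge0.
    rewrite /k; case: ifP => _; last by move=> x y [].
    move=> x y [u Hu xu] [v Hv yv].
    have := metric_triangle x u y; have := metric_triangle u v y.
    have := Hh i u v Hu Hv; rewrite (metric_sym v y) /L.
    by have := h0 i; lra.
  rewrite (nneseries_split 0 n) => [|i _]; last by rewrite lee_fin powR_ge0.
  rewrite add0n big1_seq ?add0e => [|i /=]; last first.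
    rewrite mem_index_iota /k => /andP[_ ni].
    by rewrite leqNgt ni/= powR0// gt_eqF.
  apply: (@le_trans _ _ ((L `^ t)%:E * \sum_(n <= i <oo) (h i `^ t)%:E)%E).
    rewrite -nneseriesZl => [|i _]; last exact: ht0.
    rewrite eseries_cond [leRHS]eseries_cond; apply: lee_nneseries => i /=.
      by rewrite lee_fin powR_ge0.
    by rewrite /k => ->; rewrite -EFinM powRM.
  apply: (@le_trans _ _ ((L `^ t)%:E * (e / (L `^ t + 1))%:E)%E).
    by rewrite lee_wpmul2l ?lee_fin ?powR_ge0// ltW.
  rewrite -EFinM lee_fin mulrA ler_pdivrMr ?ltr_wpDl ?powR_ge0//.
  by have := powR_ge0 L t; nra.
have Hvsmall := heavy_balls_content delta0 nets t0 tr c0 M2 h0 Hh.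
set W := (X in (hausdorff_content t X <= _)%E) in Hvsmall.
have Vsub : V `<=` \bigcup_i H i `|` (T `|` W).
  move=> y Vy.
  have [[i Hiy]|/forallNP nH] := pselect (exists i, H i y).
    by left; exists i.
  right; have [yT|nT] := pselect (T y); first by left.
  right.
  have [e1 e10 ye1] := closed_avoid_ball n cH nH.
  have [e2 e20 ye2] := fat y Vy nH.
  have m0 : 0 < Num.min (e1 / 2) e2 by rewrite lt_min divr_gt0.
  have [k] := divr_exp2_small delta m0; rewrite lt_min => /andP[ke1 ke2].
  have rho0 : 0 < delta / 2 ^+ k by rewrite divr_gt0// exprn_gt0.
  have [z zX yz] := nets.1 k y.
  exists k => //; exists z; split => //; last by rewrite ballEmdist/= metric_sym.
  apply/asboolP; split; last exact: ye2.
  move=> i [u [Hu]]; rewrite ballEmdist/= => zu.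
  have yu := metric_triangle y z u.
  have ni : (n <= i)%N.
    rewrite leqNgt; apply/negP => /ye1; apply/eqP/set0P.
    by exists u; split => //; rewrite ballEmdist/=; lra.
  rewrite ltNge; apply/negP => hi; apply: nT; exists i => //; rewrite ni.
  by exists u => //; lra.
apply: le_trans (hausdorff_content_mono t Vsub) _.
apply: le_trans (hausdorff_contentU _ _ _) _; rewrite -addrA EFinD; apply: leeD.
  by rewrite -SE; exact: content_le_series.
apply: le_trans (hausdorff_contentU _ _ _) _; rewrite EFinD; apply: leeD => //.
by rewrite EFinM -SE.
Unshelve. all: by end_near. Qed.

End fat_uncovered_points.

Section content_of_fat_sets.
Context {R : realType} {A : pointedMetricType R}.

Lemma heavy_const_ge0 N (t r c : R) : 0 < c -> t < r -> 0 <= heavy_const N t r c.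
Proof.
move=> c0 tr; have p0 : 0 < r - t by rewrite subr_gt0.
have q1 := @gt0_ltr_powR R (r - t) p0 1 2.
rewrite /heavy_const mulr_ge0 ?divr_ge0 ?mulr_ge0 ?powR_ge0 ?ler0n ?(ltW c0)//.
rewrite subr_ge0; move: q1.
by rewrite powR1 !nnegrE ler01 ler0n ltr1n => /(_ isT isT isT)/ltW.
Qed.

(** The covering principle behind both main steps, obtained by letting the
    enlargement factor M tend to infinity: a cover that is fat, at an exponent
    above t, near all the points it misses can be completed at no extra t-cost. *)
Lemma content_le_of_fat_uncovered delta N (X : nat -> seq A) t r c H h
    (V : set A) :
  0 < delta -> bounded_nets delta N X -> 0 < t -> t < r -> 0 < c ->
  (forall i, 0 <= h i) -> (forall i, width_le (h i) (H i)) ->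
  (forall i, closed (H i)) -> fat_uncovered r c H h V ->
  (hausdorff_content t V <= \sum_(i <oo) (h i `^ t)%:E)%E.
Proof.
move=> delta0 nets t0 tr c0 h0 Hh cH fat.
have : (0 <= \sum_(i <oo) (h i `^ t)%:E)%E.
  by apply: nneseries_ge0 => *; rewrite lee_fin powR_ge0.
case SE : (\sum_(i <oo) (h i `^ t)%:E)%E => [S||]; [|by move=> _; rewrite leey|by rewrite leeNy_eq].
rewrite lee_fin => S0; apply/lee_addgt0Pr => e e0.
set C := heavy_const N t r c.
have C0 : 0 <= C by exact: heavy_const_ge0.
have p0 : 0 < r - t by rewrite subr_gt0.
have CS : 0 <= C * S by exact: mulr_ge0.
have e2 : 0 < e / 2 by rewrite divr_gt0.
(* M is chosen so that the cost C (2/M)^(r-t) S of the heavy balls is at most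
   e/2; the bound u <= 1 keeps M >= 2. *)
pose q := (e / 2) / (C * S + 1).
have q0 : 0 < q by rewrite divr_gt0// ltr_wpDl.
pose u := Num.min 1 (q `^ (r - t)^-1).
have u0 : 0 < u by rewrite /u lt_min ltr01 powR_gt0.
have u1 : u <= 1 by rewrite /u ge_min lexx.
have M2 : 2 <= 2 / u by rewrite ler_pdivlMr// ler_piMr.
apply: (le_trans (content_le_of_fat_uncovered_scale delta0 nets t0 tr c0 M2 e2 h0 Hh cH fat SE)).
rewrite -/C -EFinD lee_fin.
have -> : 2 / (2 / u) = u by field; rewrite gt_eqF.
have uq : u `^ (r - t) <= q.
  have -> : q = (q `^ (r - t)^-1) `^ (r - t).
    by rewrite -powRrM mulVf ?gt_eqF// powRr1// ltW.
  by rewrite ge0_ler_powR ?nnegrE ?powR_ge0 ?(ltW u0) ?(ltW p0)// /u ge_min lexx orbT.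
have : q * (C * S) <= e / 2.
  by rewrite /q -mulrA ler_piMr ?(ltW e2)// mulrC ler_pdivrMr ?ltr_wpDl// mul1r lerDl.
have : u `^ (r - t) * (C * S) <= q * (C * S) by rewrite ler_wpM2r.
lra.
Qed.

End content_of_fat_sets.

(** * Thick sets *)

Section thick_sets.
Context {R : realType} {A : pointedMetricType R}.

Definition thick rho0 t (E : set A) := exists2 c, 0 < c &
  forall x rho, 0 < rho -> rho <= rho0 ->
    ((c * rho `^ t)%:E <= hausdorff_content t (E `&` ball x rho))%E.

(** Emptying the members that miss B, rather than discarding them, keeps the
    cover indexed by the natural numbers. *)
Definition meeting_sets (H : nat -> set A) (B : set A) i :=
  if `[< H i `&` B !=set0 >] then H i else set0.

Definition meeting_widths (H : nat -> set A) (h : nat -> R) (B : set A) i :=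
  if `[< H i `&` B !=set0 >] then h i else 0.

Lemma cover_massE r H h (B : set A) : 0 < r ->
  cover_mass r H h B = (\sum_(i <oo) (meeting_widths H h B i `^ r)%:E)%E.
Proof.
move=> r0; apply: eq_eseriesr => i _; rewrite /meeting_widths.
by case: ifP => // _; rewrite powR0// gt_eqF.
Qed.

Lemma meeting_widths_ge0 H h (B : set A) i : (forall i, 0 <= h i) ->
  0 <= meeting_widths H h B i.
Proof. by move=> h0; rewrite /meeting_widths; case: ifP. Qed.

Lemma width_le_meeting H h (B : set A) i : (forall i, width_le (h i) (H i)) ->
  width_le (meeting_widths H h B i) (meeting_sets H B i).
Proof.
by move=> Hh; rewrite /meeting_widths /meeting_sets; case: ifP => // _ x y [].
Qed.

Lemma content_le_cover_mass r H h (E B : set A) : 0 < r ->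
  (forall i, 0 <= h i) -> (forall i, width_le (h i) (H i)) ->
  E `&` B `<=` \bigcup_i H i ->
  (hausdorff_content r (E `&` B) <= cover_mass r H h B)%E.
Proof.
move=> r0 h0 Hh EBH; rewrite cover_massE//.
apply: (@content_le_series _ _ _ _ (meeting_sets H B)) => // [i|i|y [Ey By]].
- exact: meeting_widths_ge0.
- exact: width_le_meeting.
- have [i _ Hy] := EBH y (conj Ey By); exists i => //.
  by rewrite /meeting_sets ifT//; apply/asboolP; exists y.
Qed.

(** Near every point of V the cover of E n V is fat, by thickness of E, so that
    it can be completed to a cover of V. *)
Lemma thick_full_content rho0 delta N (X : nat -> seq A) t r (E V : set A) :
  0 < rho0 -> 0 < delta -> bounded_nets delta N X ->
  0 < t -> t < r -> thick rho0 r E -> open V ->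
  hausdorff_content t (E `&` V) = hausdorff_content t V.
Proof.
move=> rho00 delta0 nets t0 tr [c c0 thE] oV; apply/eqP; rewrite eq_le.
rewrite hausdorff_content_mono/=; last by move=> x [].
rewrite leNgt; apply/negP => lt_content.
have [H [h [cH h0 Hh EH HL]]] := content_lt_cover t0 lt_content.
have h0' i : 0 <= h i by exact: ltW.
have Hh' i : width_le (h i) (H i) by move=> x y Hx Hy; exact/ltW/Hh.
suff : (hausdorff_content t V <= \sum_(i <oo) (h i `^ t)%:E)%E.
  by move=> /(lt_le_trans HL); rewrite ltxx.
apply: (content_le_of_fat_uncovered delta0 nets t0 tr c0) => // y Vy _.
have /nbhs_ballP[e /= e0 eV] : nbhs y V by exact: open_nbhs_nbhs.
exists (Num.min rho0 (e / 2)); first by rewrite lt_min rho00 divr_gt0.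
move=> z rho rhogt; rewrite lt_min => /andP[rl re] yz.
apply: le_trans (thE z rho rhogt (ltW rl)) _.
apply: content_le_cover_mass => //; first exact: lt_trans tr.
move=> w [Ew]; rewrite ballEmdist/= => zw; apply: EH; split => //.
apply: eV; rewrite ballEmdist/=.
by have := metric_triangle y z w; lra.
Qed.

Lemma thick_mono rho0 t (E F : set A) : E `<=` F -> thick rho0 t E ->
  thick rho0 t F.
Proof.
move=> EF [c c0 th]; exists c => // x rho r0 r1; apply: le_trans (th x rho r0 r1) _.
by apply: hausdorff_content_mono => y [/EF].
Qed.

Lemma nested_closed_balls (x : nat -> A) (rho : nat -> R) :
  compact [set: A] -> (forall n, 0 < rho n) ->
  (forall n y, mdist (x n.+1) y <= rho n.+1 -> mdist (x n) y <= rho n) ->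
  exists y, forall n, mdist (x n) y <= rho n.
Proof.
move=> cT rho0 sub.
have subn m n y : (m <= n)%N -> mdist (x n) y <= rho n -> mdist (x m) y <= rho m.
  move=> mn; rewrite -(subnKC mn); elim: (n - m)%N => [|k IH]; first by rewrite addn0.
  by rewrite addnS => /sub.
have [y [_ cy]] := cT (x @ \oo) _ filterT.
exists y => n; rewrite leNgt; apply/negP => ny.
have e0 : 0 < mdist (x n) y - rho n by rewrite subr_gt0.
have [|z []] := cy [set z | mdist (x n) z <= rho n] _ _ (nbhsx_ballx y _ e0).
  by exists n => // m /= nm; apply: (subn n m) => //; rewrite mdistxx ltW.
move=> /= nz; rewrite ballEmdist/= => yz.
by have := metric_triangle (x n) z y; rewrite (metric_sym z y); lra.
Qed.

End thick_sets.

(** * Countable intersections of thick open sets *)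

Section intersection.
Context {R : realType} {A : pointedMetricType R}.

Lemma cover_mass_meeting r H h (B C : set A) : C `<=` B ->
  cover_mass r (meeting_sets H B) (meeting_widths H h B) C = cover_mass r H h C.
Proof.
move=> CB; apply: eq_eseriesr => i _; rewrite /meeting_sets /meeting_widths.
have [HC|nHC] := asboolP (H i `&` C !=set0).
  have HB : H i `&` B !=set0 by case: HC => y [Hy /CB]; exists y.
  by rewrite (asboolT HB) (asboolT HC).
have [HB|nHB] := asboolP (H i `&` B !=set0); first by rewrite (asboolF nHC).
by rewrite asboolF// set0I => -[].
Qed.

(** The inductive step of the intersection argument.  If no small ball in
    O n B(x, rho) were light at the larger exponent r, the members meeting
    B(x, rho) would be fat near every point of O n B(x, rho), and that set would
    have a t-content below the bound given by the thickness of O. *)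
Lemma lighter_ball rho0 delta N (X : nat -> seq A) t r c c' (O : set A) H h
    x rho (e : R) :
  0 < delta -> bounded_nets delta N X -> 0 < t -> t < r -> 0 < c' ->
  open O -> (forall i, closed (H i)) -> (forall i, 0 <= h i) ->
  (forall i, width_le (h i) (H i)) ->
  0 < rho -> rho <= rho0 -> 0 < e ->
  (forall x rho, 0 < rho -> rho <= rho0 ->
    ((c * rho `^ t)%:E <= hausdorff_content t (O `&` ball x rho))%E) ->
  (cover_mass t H h (ball x rho) < (c * rho `^ t)%:E)%E ->
  exists y rho', [/\ 0 < rho', rho' <= e,
    (forall z, mdist y z <= rho' -> O z /\ mdist x z < rho) &
    (cover_mass r H h (ball y rho') < (c' * rho' `^ r)%:E)%E].
Proof.
move=> delta0 nets t0 tr c'0 oO cH h0 Hh rhogt rhole e0 thO light.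
apply: contrapT => nolight.
pose V := O `&` ball x rho.
have oV : open V by apply: openI => //; exact: metric_ball_open.
suff : (hausdorff_content t V <= cover_mass t H h (ball x rho))%E.
  by rewrite leNgt => /negP; apply; apply: lt_le_trans light (thO _ _ rhogt rhole).
rewrite cover_massE//.
apply: (@content_le_of_fat_uncovered _ _ _ _ _ _ r c' (meeting_sets H (ball x rho)) _ V
  delta0 nets) => // [i|i|i|y Vy _].
- exact: meeting_widths_ge0.
- exact: width_le_meeting.
- by rewrite /meeting_sets; case: ifP => // _; exact: closed0.
have /nbhs_ballP[d /= d0 dV] : nbhs y V by exact: open_nbhs_nbhs.
exists (Num.min e (d / 2)); first by rewrite lt_min e0 divr_gt0.
move=> z rho' rho'0; rewrite lt_min => /andP[re rd] yz.
have zV w : mdist z w <= rho' -> V w.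
  move=> zw; apply: dV; rewrite ballEmdist/=.
  by have := metric_triangle y z w; lra.
rewrite cover_mass_meeting; last first.
  by move=> w; rewrite [ball z _]ballEmdist/= => /ltW/zV[].
rewrite leNgt; apply/negP => lightz; apply: nolight.
exists z, rho'; split => //; first exact: ltW.
by move=> w /zV[Ow]; rewrite ballEmdist.
Qed.

(** A Baire category argument in which the invariant of the nested balls is that
    the cover is cheap, at increasing exponents p j, among the members that meet
    the ball. *)
Lemma thick_bigcap rho0 delta N (X : nat -> seq A) s (O : nat -> set A) :
  0 < rho0 -> 0 < delta -> bounded_nets delta N X -> compact [set: A] ->
  (forall j, open (O j)) ->
  (forall j r, 0 < r -> r < s -> thick rho0 r (O j)) ->
  forall t, 0 < t -> t < s -> thick rho0 t (\bigcap_j O j).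
Proof.
move=> rho00 delta0 nets cT oO thO t t0 ts.
pose p j : R := s - (s - t) / j.+1%:R.
have p0 : p 0%N = t by rewrite /p divr1; ring.
have st0 : 0 < s - t by rewrite subr_gt0.
have pS j : p j < p j.+1.
  by rewrite /p ltrD2l ltrN2 ltr_pM2l// ltf_pV2 ?posrE ?ltr0n// ltr_nat.
have ps j : p j < s by rewrite /p gtrBl divr_gt0.
have pgt j : 0 < p j.
  elim: j => [|j IH]; first by rewrite p0.
  exact: lt_trans (pS j).
have /choice[c cP] : forall j, exists c, [/\ 0 < c, c <= 1 & forall x rho,
    0 < rho -> rho <= rho0 ->
    ((c * rho `^ p j)%:E <= hausdorff_content (p j) (O j `&` ball x rho))%E].
  move=> j; have [c c0 cP] := thO j (p j) (pgt j) (ps j).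
  exists (Num.min c 1); split; rewrite ?lt_min ?c0 ?ltr01 ?ge_min ?lexx ?orbT//.
  move=> x rho r0 r1; apply: le_trans (cP x rho r0 r1).
  by rewrite lee_fin ler_wpM2r ?powR_ge0// ge_min lexx.
exists (c 0%N); first by case: (cP 0%N).
move=> x rho r0 r1; rewrite leNgt; apply/negP; rewrite -p0 => small.
have [H [h [cH h0 Hh EH HL]]] := content_lt_cover (pgt 0%N) small.
have h0' i : 0 <= h i by exact: ltW.
have Hh' i : width_le (h i) (H i) by move=> u v Hu Hv; exact/ltW/Hh.
(* The ball is a pair (centre, radius). *)
pose light (j : nat) (b : A * R) := [/\ 0 < b.2, b.2 <= rho0 / 2 ^+ j &
  (cover_mass (p j) H h (ball b.1 b.2) < (c j * b.2 `^ p j)%:E)%E].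
pose inside (j : nat) (b b' : A * R) := forall z, mdist b'.1 z <= b'.2 ->
  O j z /\ mdist b.1 z < b.2.
have /choice[next nextP] : forall jb : nat * (A * R), exists b' : A * R,
    light jb.1 jb.2 -> light jb.1.+1 b' /\ inside jb.1 jb.2 b'.
  move=> [j [y d]] /=; have [lj|] := pselect (light j (y, d)); last first.
    by exists (x, rho).
  case: (lj) => /= d0 dle ld.
  have [_ _ cj] := cP j; have [c'0 _ _] := cP j.+1.
  have dr : d <= rho0.
    by apply: le_trans dle _; rewrite ler_pdivrMr ?exprn_gt0// ler_peMr ?(ltW rho00)// exprn_ege1// ler1n.
  have e0 : 0 < rho0 / 2 ^+ j.+1 by rewrite divr_gt0// exprn_gt0.
  have [z [d' [d'0 d'e zin lz]]] := lighter_ball delta0 nets (pgt j) (pS j) c'0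
    (oO j) cH h0' Hh' d0 dr e0 cj ld.
  by exists (z, d') => _; split.
pose b := fix b j := if j is j'.+1 then next (j', b j') else (x, rho).
have bP j : light j (b j).
  elim: j => [|j /(nextP (j, b j))[]//].
  split => //=; first by rewrite expr0 divr1.
  apply: le_lt_trans HL; rewrite cover_massE//; apply: lee_nneseries => i _.
    by rewrite lee_fin powR_ge0.
  rewrite lee_fin /meeting_widths; case: ifP => // _.
  by rewrite powR0 ?powR_ge0// gt_eqF.
have bin j : inside j (b j) (b j.+1) by have [] := nextP (j, b j) (bP j).
have [||y yb] := @nested_closed_balls _ _ (fun j => (b j).1) (fun j => (b j).2) cT.
- by move=> j; case: (bP j).
- by move=> j z /bin[_ /ltW].
have yin j : O j y /\ mdist (b j).1 y < (b j).2 by exact: bin (yb j.+1).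
have [i _ Hy] : (\bigcup_i H i) y.
  apply: EH; split; first by move=> j _; case: (yin j).
  by rewrite ballEmdist/=; case: (yin 0%N).
(* The common point y lies in some H i, which is therefore one of the members
   meeting each ball; since c k <= 1, the width h i is below every radius. *)
have [k kh] := divr_exp2_small rho0 (h0 i).
have [bk0 bkle lk] := bP k.
have [_ ck1 _] := cP k.
have : h i `^ p k < (b k).2 `^ p k.
  rewrite -lte_fin; apply: le_lt_trans (lt_le_trans lk _); last first.
    by rewrite lee_fin ler_piMl// powR_ge0.
  rewrite /cover_mass (@nneseriesD1 _ _ i)//; last first.
    by move=> m _; case: ifP => // _; rewrite lee_fin powR_ge0.
  rewrite ifT; last first.
    by apply/asboolP; exists y; split => //; rewrite ballEmdist/=; case: (yin k).
  rewrite leeDl//; apply: nneseries_ge0 => m *.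
  by case: ifP => // _; rewrite lee_fin powR_ge0.
apply/negP; rewrite -leNgt ge0_ler_powR ?nnegrE ?(ltW (pgt k)) ?(ltW bk0)//.
exact: le_trans bkle (ltW kh).
Qed.

End intersection.

(** * Dyadic cells and separated sets *)

Section dyadic_cells.
Context {R : realType} {A : pointedMetricType R}.

(** Cells have positive finite diameter because they are nonempty and contained
    in an open ball of radius a fine(diam(Q)), which is empty if the diameter is
    0 or infinite.  At scale rho, the cell through x is taken in the first
    generation all of whose cells have diameter below rho; some cell of the
    preceding generation has diameter at least rho, and consecutive generations
    are comparable. *)
Lemma dyadic_geometry (D : set (set A)) : dyadic_decomposition D ->
  exists a K rho1 : R, [/\ 1 <= a, 1 <= K, 0 < rho1 & [/\
    (forall Q, D Q -> exists x d,
       [/\ Q x, 0 < d, diameter Q = d%:E & ball x (d / a) `<=` Q]),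
    (forall x rho, 0 < rho -> rho <= rho1 -> exists Q d,
       [/\ D Q, Q x, diameter Q = d%:E, d < rho & rho <= K * d]),
    (forall e, 0 < e -> finite_set [set Q | D Q /\ (e%:E <= diameter Q)%E]) &
    (forall e, 0 < e -> exists F : set (set A), [/\ finite_set F,
       \bigcup_(Q in F) Q = setT & forall Q, F Q -> width_le e Q])]].
Proof.
move=> [_ [a [b [C [n0 [W [[a1 _ C1 _ DE]
  [[WP Wlim] Wball _ _ Wratio]]]]]]]].
have cell Q : D Q -> exists x d,
    [/\ Q x, 0 < d, diameter Q = d%:E & ball x (d / a) `<=` Q].
  move=> DQ; have [x [Qx xQ Qsub]] := Wball Q DQ.
  have := Qsub x Qx; rewrite ballEmdist/= mdistxx => fd.
  have d0 : 0 < fine (diameter Q).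
    by rewrite -(pmulr_rgt0 _ (lt_le_trans ltr01 a1)).
  exists x, (fine (diameter Q)); split => //.
  by rewrite fineK//; case: (diameter Q) d0 => [r|/=|/=]; rewrite ?ltxx.
have small e : 0 < e -> exists n, forall m Q, (n <= m)%N -> W m Q -> (diameter Q < e%:E)%E.
  move=> e0; move/fine_cvgP: Wlim => [supfin /cvgrPdist_lt/(_ _ e0) Wlim].
  have [n _ nP] : \forall n \near \oo,
      (ereal_sup [set diameter Q | Q in W n] < e%:E)%E.
    near=> m; rewrite -[ltLHS]fineK; last by near: m; exact: supfin.
    rewrite lte_fin; apply: le_lt_trans (ler_norm _) _.
    by rewrite -normrN -sub0r; near: m.
  exists n => m Q /nP nm WQ; apply: le_lt_trans nm.
  by apply: ereal_sup_ubound; exists Q.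
have WD n Q : W n Q -> D Q by rewrite DE => WQ; exists n.
have cov n x : exists2 Q, W n Q & Q x.
  have : (\bigcup_(Q in W n) Q) x by rewrite (WP n).2.
  by move=> [Q WQ Qx]; exists Q.
have [Q0 WQ0 _] := cov 0%N point.
have [_ [d0 [_ d00 Q0d _]]] := cell Q0 (WD _ _ WQ0).
exists a, C, d0; split => //; split => //.
- move=> x rho rho0 rhod0.
  pose P n := `[< forall Q, W n Q -> (diameter Q < rho%:E)%E >].
  have exP : exists n, P n.
    by have [n nP] := small rho rho0; exists n; apply/asboolP => Q; exact: nP.
  case: (ex_minnP exP) => -[|n] /asboolP Pn nmin.
    by have := Pn Q0 WQ0; rewrite Q0d lte_fin ltNge rhod0.
  have [Q WQ Qx] := cov n.+1 x.
  have [_ [d [_ dgt Qd _]]] := cell Q (WD _ _ WQ).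
  have := Pn Q WQ; rewrite Qd lte_fin => drho.
  exists Q, d; split => //; first exact: WD WQ.
  rewrite leNgt; apply/negP => Cd.
  have : (n.+1 <= n)%N; last by rewrite ltnn.
  apply: nmin; apply/asboolP => Q1 WQ1.
  have /andP[_] := Wratio n Q1 Q WQ1 WQ.
  by rewrite Qd => /le_lt_trans; apply; rewrite -EFinM lte_fin.
- move=> e e0; have [n nP] := small e e0.
  apply: (@sub_finite_set _ _ (\bigcup_(m in `I_n) W m)).
    move=> Q /= [DQ eQ]; move: DQ; rewrite DE => -[m _ WQ].
    exists m => //=; rewrite ltnNge; apply/negP => nm.
    by have := nP m Q nm WQ; rewrite ltNge eQ.
  by apply: bigcup_finite => // m _; exact: (WP m).1.
- move=> e e0; have [n nP] := small e e0.
  exists (W n); split; [exact: (WP n).1|exact: (WP n).2|].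
  by move=> Q WQ; apply/(width_leP _ (ltW e0)); apply/ltW/(nP n).
Unshelve. all: by end_near. Qed.

Definition totally_bounded_space := forall e : R, 0 < e ->
  exists F : set (set A), [/\ finite_set F,
    \bigcup_(Q in F) Q = setT & forall Q, F Q -> width_le e Q].

Lemma totally_bounded_bounded : totally_bounded_space ->
  forall x0 : A, exists L : R, forall y, mdist x0 y <= L.
Proof.
move=> /(_ 1 ltr01)[F [/finite_seqP[s ->] cov wF]] x0.
suff [L LP] : exists L, forall Q, Q \in s -> forall y, Q y -> mdist x0 y <= L.
  exists L => y; have : (\bigcup_(Q in [set` s]) Q) y by rewrite cov.
  by move=> [Q /= /LP]; apply.
have {}wF Q : Q \in s -> width_le 1 Q by exact: wF.
elim: s wF {cov} => [|Q s IH] wF; first by exists 0.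
have [|L LP] := IH; first by move=> Q' sQ'; apply: wF; rewrite inE sQ' orbT.
have [[q Qq]|Q0] := pselect (Q !=set0); last first.
  exists L => Q'; rewrite inE => /orP[/eqP ->|/LP//] y Qy.
  by case: Q0; exists y.
exists (Num.max L (mdist x0 q + 1)) => Q'; rewrite inE => /orP[/eqP ->|/LP Q'L] y Qy.
  rewrite le_max; apply/orP; right.
  have := wF Q (mem_head _ _) q y Qq Qy.
  by have := metric_triangle x0 q y; lra.
by rewrite le_max Q'L.
Qed.

Lemma proper_bounded_compact : proper_metric A ->
  (forall x0 : A, exists L : R, forall y, mdist x0 y <= L) ->
  compact [set: A].
Proof.
move=> pA /(_ point)[L LP].
rewrite (_ : setT = [set y | mdist point y <= L]); first exact: pA.
by apply/seteqP; split => y _ //=.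
Qed.

Definition separated (rho : R) (s : seq A) :=
  pairwise (fun x y => rho <= mdist x y) s.

(** A set of diameter at most rho/2 contains at most one point of a rho-separated
    set. *)
Lemma separated_size_bounded rho : totally_bounded_space -> 0 < rho ->
  exists n, forall s, separated rho s -> (size s <= n)%N.
Proof.
move=> tb rho0; have rho2 : 0 < rho / 2 by rewrite divr_gt0.
have [F [/finite_seqP[sF ->] cov wF]] := tb _ rho2.
have /choice[f fP] : forall x : A, exists Q, Q \in sF /\ Q x.
  move=> x; have : (\bigcup_(Q in [set` sF]) Q) x by rewrite cov.
  by move=> [Q /= sQ Qx]; exists Q.
exists (size sF) => s sep; rewrite -(size_map f).
apply: uniq_leq_size; last by move=> _ /mapP[x _ ->]; case: (fP x).
rewrite uniq_pairwise pairwise_map; apply: sub_pairwise sep => x y xy /=.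
apply/eqP => fxy; have [Fx fx] := fP x; have [_ fy] := fP y.
by have := wF _ Fx x y fx; rewrite fxy => /(_ fy); lra.
Qed.

(** A separated set of maximal size is a net. *)
Lemma separated_net rho : totally_bounded_space -> 0 < rho ->
  exists2 s, separated rho s & forall y, exists2 z, z \in s & mdist y z < rho.
Proof.
move=> tb rho0; have [n nP] := separated_size_bounded tb rho0.
pose P m := `[< exists2 s, separated rho s & size s = m >].
have exP : exists m, P m by exists 0%N; apply/asboolP; exists [::].
have ubP m : P m -> (m <= n)%N by move=> /asboolP[s /nP + <-].
case: (ex_maxnP exP ubP) => m /asboolP[s sep sm] mmax.
exists s => // y; apply: contrapT => noz.
have : (m.+1 <= m)%N; last by rewrite ltnn.
apply: mmax; apply/asboolP; exists (y :: s); last by rewrite /= sm.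
rewrite /separated pairwise_cons -/(separated rho s) sep andbT; apply/allP => z zs.
by rewrite leNgt; apply/negP => yz; apply: noz; exists z.
Qed.

End dyadic_cells.
Arguments totally_bounded_space {R} A.

(** * Ahlfors regular measures *)

Section ahlfors.
Context {R : realType} {A : pointedMetricType R} (dim : R)
  (mu : {measure set (borelType A) -> \bar R}).
Implicit Types (x y : A) (r : R).

Definition ahlfors_bounds (C r0 : R) := [/\ 1 <= C, 0 < r0 &
  forall x r, 0 < r -> r < r0 ->
    ((C^-1 * r `^ dim)%:E <= mu (ball x r) <= (C * r `^ dim)%:E)%E].

Lemma measurable_ball x r : measurable (ball x r : set (borelType A)).
Proof. by apply: sub_sigma_algebra; exact: metric_ball_open. Qed.

Lemma measurable_closed (F : set A) : closed F -> measurable (F : set (borelType A)).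
Proof.
move=> cF; rewrite -[F]setCK; apply: measurableC.
by apply: sub_sigma_algebra; exact: closed_openC.
Qed.

(** The mass distribution principle: mu(H_i) <= C h_i^dim and h_i < rho give
    mu(H_i) <= C rho^(dim-t) h_i^t.  The constant does not depend on t, which
    matters when the exponent tends to a limit. *)
Lemma content_ball_ge C r0 t x rho : ahlfors_bounds C r0 ->
  0 < t -> t < dim -> 0 < rho -> rho < r0 ->
  ((C ^- 2 * rho `^ t)%:E <= hausdorff_content t (ball x rho))%E.
Proof.
move=> [C1 r00 reg] t0 td rho0 rhor; rewrite leNgt; apply/negP => small.
have C0 : 0 < C by exact: lt_le_trans C1.
have [H [h [cH h0 Hh EH HL]]] := content_lt_cover t0 small.
have dim0 : 0 < dim by exact: lt_trans td.
have ht0 i : (0 <= (h i `^ t)%:E)%E by rewrite lee_fin powR_ge0.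
have C21 : C ^- 2 <= 1 by rewrite invf_le1 ?exprn_gt0// exprn_ege1.
have hrho i : h i < rho.
  have : ((h i `^ t)%:E < (rho `^ t)%:E)%E.
    apply: (@le_lt_trans _ _ (\sum_(i <oo) (h i `^ t)%:E)%E).
      rewrite (@nneseriesD1 _ _ i)//.
      by rewrite leeDl//; apply: nneseries_ge0 => *; exact: ht0.
    by apply: (lt_le_trans HL); rewrite lee_fin ler_piMl ?powR_ge0.
  rewrite lte_fin !ltNge; apply: contraNN => rh.
  by rewrite ge0_ler_powR ?nnegrE ?(ltW t0) ?(ltW rho0) ?(ltW (h0 i)).
have muH i : (mu (H i) <= (C * rho `^ (dim - t))%:E * (h i `^ t)%:E)%E.
  have [[y Hy]|] := pselect (H i !=set0); last first.
    move=> /set0P/negP/negPn/eqP ->; rewrite measure0 mule_ge0// lee_fin.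
    by rewrite mulr_ge0 ?powR_ge0// ltW.
  apply: (@le_trans _ _ (mu (ball y (h i)))).
    apply: le_measure; rewrite ?inE; [exact: measurable_closed|exact: measurable_ball|].
    by move=> z Hz; rewrite ballEmdist/=; exact: Hh.
  have /andP[_ /le_trans] := reg y (h i) (h0 i) (lt_trans (hrho i) rhor); apply.
  rewrite -EFinM lee_fin -mulrA ler_pM2l//.
  have -> : h i `^ dim = h i `^ (dim - t) * h i `^ t.
    by rewrite -powRD ?subrK// gt_eqF.
  rewrite ler_wpM2r ?powR_ge0// ge0_ler_powR ?nnegrE ?subr_ge0 ?ltW//.
have /andP[+ _] := reg x rho rho0 rhor; apply/negP; rewrite -ltNge.
apply: (@le_lt_trans _ _ (\sum_(i <oo) mu (H i))%E).
  apply: measure_sigma_subadditive => // [i|]; first exact: measurable_closed.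
  exact: measurable_ball.
apply: (@le_lt_trans _ _ ((C * rho `^ (dim - t))%:E * \sum_(i <oo) (h i `^ t)%:E)%E).
  rewrite -nneseriesZl => [|i _]; last exact: ht0.
  by apply: lee_nneseries => // i _; exact: muH.
have CR0 : 0 < C * rho `^ (dim - t) by rewrite mulr_gt0 ?powR_gt0.
apply: (@lt_le_trans _ _ ((C * rho `^ (dim - t))%:E * (C ^- 2 * rho `^ t)%:E)%E).
  by rewrite lte_pmul2l.
have E : rho `^ dim = rho `^ (dim - t) * rho `^ t.
  by rewrite -powRD ?subrK// gt_eqF.
rewrite -EFinM lee_fin E le_eqVlt; apply/orP; left; apply/eqP; field.
by rewrite gt_eqF.
Qed.

Lemma separated_ball_measure C r0 rho s : ahlfors_bounds C r0 ->
  0 < rho -> rho / 2 < r0 -> separated rho s ->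
  (((size s)%:R * (C^-1 * (rho / 2) `^ dim))%:E <=
   mu [set y | exists2 z, z \in s & ball z (rho / 2) y])%E /\
  measurable ([set y | exists2 z, z \in s & ball z (rho / 2) y] : set (borelType A)).
Proof.
move=> [C1 r00 reg] rho0 rhor; elim: s => [|z s IH] sep.
  rewrite mul0r (_ : mkset _ = set0) ?measure0; first by split.
  by rewrite -subset0 => y [z].
move: sep; rewrite /separated pairwise_cons -/(separated rho s) => /andP[/allP zs] /IH[IHs ms].
set S := mkset _ in IHs ms.
have -> : [set y | exists2 z0, z0 \in z :: s & ball z0 (rho / 2) y] =
    (ball z (rho / 2) `|` S).
  apply/seteqP; split => y /=.
    by move=> [u]; rewrite inE => /orP[/eqP ->|us] uy; [left|right; exists u].
  by move=> [zy|[u us uy]]; [exists z; rewrite ?mem_head|exists u; rewrite // inE us orbT].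
split; last by apply: measurableU => //; exact: measurable_ball.
rewrite measureU//; last 2 first.
- exact: measurable_ball.
- rewrite -subset0 => y []; rewrite ballEmdist/= => zy [u us].
  rewrite ballEmdist/= => uy; have := zs u us.
  by have := metric_triangle z y u; rewrite (metric_sym y u); lra.
rewrite /= -natr1 addrC mulrDl mul1r EFinD leeD//.
by case/andP: (reg z (rho / 2) (divr_gt0 rho0 (ltr0Sn R 1)) rhor).
Qed.

(** The balls of radius rho/2 about the points of a rho-separated set are
    disjoint; comparing their measures with that of a ball of radius 3 rho bounds
    the number of these points in a ball of radius 2 rho by C^2 6^dim. *)
Lemma ahlfors_nets C r0 delta : ahlfors_bounds C r0 ->
  totally_bounded_space A -> 0 < delta -> 3 * delta < r0 ->
  exists N X, @bounded_nets R A delta N X.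
Proof.
move=> bnd tb delta0 deltar.
have dk k : 0 < delta / 2 ^+ k by rewrite divr_gt0// exprn_gt0.
have /choice[X XP] : forall k, exists s, separated (delta / 2 ^+ k) s /\
    forall y, exists2 z, z \in s & mdist y z < delta / 2 ^+ k.
  by move=> k; have [s sep cov] := @separated_net R A _ tb (dk k); exists s.
exists (Num.bound (C ^+ 2 * 6 `^ dim)), X; split => [k|k w]; first exact: (XP k).2.
case: (bnd) => C1 r00 reg.
have C0 : 0 < C by exact: lt_le_trans C1.
set rho := delta / 2 ^+ k.
have rhod : rho <= delta by rewrite /rho ler_pdivrMr ?exprn_gt0// ler_peMr ?(ltW delta0)// exprn_ege1// ler1n.
have rho0 : 0 < rho by exact: dk.
rewrite -size_filter; set s := (X in size X).
have sep : separated rho s by apply: pairwise_filter; exact: (XP k).1.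
have rho2 : rho / 2 < r0 by lra.
have [sge sm] := separated_ball_measure bnd rho0 rho2 sep.
have sle : ((size s)%:R * (C^-1 * (rho / 2) `^ dim) <= C * (3 * rho) `^ dim).
  rewrite -lee_fin; apply: le_trans sge _.
  apply: (@le_trans _ _ (mu (ball w (3 * rho)))).
    apply: le_measure; rewrite ?inE//; first exact: measurable_ball.
    move=> y [z]; rewrite mem_filter !ballEmdist/= => /andP[zw _] zy.
    by have := metric_triangle w z y; rewrite (metric_sym w z) -/rho in zw *; lra.
  have r3 : 0 < 3 * rho by rewrite mulr_gt0.
  have r4 : 3 * rho < r0 by lra.
  by case/andP: (reg w (3 * rho) r3 r4).
rewrite -(ler_nat R); apply/ltW; apply: le_lt_trans (archi_boundP _); last first.
  by rewrite mulr_ge0 ?powR_ge0 ?exprn_ge0 ?ltW.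
move: sle; have -> : 3 * rho = 6 * (rho / 2) by field.
have hr : 0 <= rho / 2 by rewrite divr_ge0// ltW.
have p0 : 0 < (rho / 2) `^ dim by rewrite powR_gt0// divr_gt0.
rewrite (powRM _ _ hr)// mulrA mulrA ler_pM2r// ler_pdivrMr// => /le_trans; apply.
rewrite le_eqVlt; apply/orP; left; apply/eqP; ring.
Qed.

End ahlfors.

(** * From density in the cells to full content *)

Section content_hat.
Context {R : realType} {A : pointedMetricType R}.

Lemma content_hat_le t u (E F : set A) : t < u ->
  (forall r, t < r -> r < u ->
     (hausdorff_content r E <= hausdorff_content r F)%E) ->
  (hausdorff_content_hat t E <= hausdorff_content_hat t F)%E.
Proof.
move=> tu EF; apply: le_ereal_inf_tmp => _ [V tV <-].
have tW : (t^'+) (V `&` [set r | t < r < u]).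
  apply: filterI => //; near=> r; apply/andP; split; near: r.
    exact: nbhs_right_gt.
  exact: nbhs_right_lt.
apply: (@le_trans _ _ (ereal_sup [set hausdorff_content r E |
    r in V `&` [set r | t < r < u]])).
  by apply: ereal_inf_lbound; exists (V `&` [set r | t < r < u]).
apply: ge_ereal_sup => _ [r [Vr /andP[tr ru]] <-].
apply: le_trans (EF r tr ru) _.
by apply: ereal_sup_ubound; exists r.
Unshelve. all: by end_near. Qed.

Lemma content_hat_eq t u (E F : set A) : t < u ->
  (forall r, t < r -> r < u ->
     hausdorff_content r E = hausdorff_content r F) ->
  hausdorff_content_hat t E = hausdorff_content_hat t F.
Proof.
move=> tu EF; apply/eqP; rewrite eq_le; apply/andP.
by split; apply: (content_hat_le tu) => r r1 r2; rewrite EF.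
Qed.

Lemma content_hat_le_bound t u (E : set A) (L : \bar R) : t < u ->
  (forall r, t < r -> r < u -> (hausdorff_content r E <= L)%E) ->
  (hausdorff_content_hat t E <= L)%E.
Proof.
move=> tu EL.
apply: (@le_trans _ _ (ereal_sup [set hausdorff_content r E |
    r in [set r | t < r < u]])).
  apply: ereal_inf_lbound; exists [set r | t < r < u] => //.
  near=> r; apply/andP; split; near: r.
    exact: nbhs_right_gt.
  exact: nbhs_right_lt.
by apply: ge_ereal_sup => _ [r /andP[? ?] <-]; exact: EL.
Unshelve. all: by end_near. Qed.

Lemma content_hat_ge_bound t u (E : set A) (L : \bar R) : t < u ->
  (forall r, t < r -> r < u -> (L <= hausdorff_content r E)%E) ->
  (L <= hausdorff_content_hat t E)%E.
Proof.
move=> tu EL; apply: le_ereal_inf_tmp => _ [V tV <-].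
have : (t^'+) (V `&` [set r | t < r < u]).
  apply: filterI => //; near=> r; apply/andP; split; near: r.
    exact: nbhs_right_gt.
  exact: nbhs_right_lt.
move=> /filter_ex[r [Vr /andP[tr ru]]].
by apply: le_trans (EL r tr ru) _; apply: ereal_sup_ubound; exists r.
Unshelve. all: by end_near. Qed.

End content_hat.

Lemma countable_bigcap_seq (T : Type) (G : set (set T)) : countable G ->
  exists e : nat -> set T, (forall n, G (e n) \/ e n = setT) /\
    \bigcap_(E in G) E = \bigcap_n e n.
Proof.
move=> /countable_injP[f finj].
have /choice[e eP] : forall n, exists E, (G E /\ f E = n) \/
    (E = setT /\ forall E', G E' -> f E' <> n).
  move=> n; have [[E GE]|noE] := pselect (exists2 E, G E & f E = n).
    by exists E; left.
  exists setT; right; split => // E' GE' E'n.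
  by apply: noE; exists E'.
exists e; split=> [n|]; first by case: (eP n) => [[]|[]]; [left|right].
apply/seteqP; split => x xG n.
  by move=> _; case: (eP n) => [[Gn _]|[-> _]//]; exact: xG.
move=> Gn; have := xG (f n) I; case: (eP (f n)) => [[Ge fe]|[_ /(_ n Gn)//]].
by rewrite (finj _ _ _ _ fe) ?inE.
Qed.

Lemma bigcap_Gdelta_open (T : topologicalType) (e : nat -> set T) :
  (forall n, Gdelta (e n)) ->
  exists O : nat -> set T, [/\ forall j, open (O j),
    forall j, exists n, e n `<=` O j & \bigcap_n e n = \bigcap_j O j].
Proof.
move=> /(_ _)/cid2 Ge; pose B n := projT1 (Ge n).
have BP n : (forall i, open (B n i)) /\ e n = \bigcap_i B n i.
  by rewrite /B; case: (Ge n).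
pose O j := if unpickle j is Some p then B p.1 p.2 else setT.
have OB n i : O (pickle (n, i)) = B n i by rewrite /O pickleK.
exists O; split.
- by move=> j; rewrite /O; case: unpickle => [p|]; [exact: (BP p.1).1|exact: openT].
- move=> j; rewrite /O; case: unpickle => [p|]; last by exists 0%N.
  by exists p.1; rewrite (BP p.1).2 => x /(_ p.2); apply.
- apply/seteqP; split => x xe n _.
    rewrite /O; case: unpickle => [p|//].
    by have := xe p.1 I; rewrite (BP p.1).2; apply.
  by rewrite (BP n).2 => i _; rewrite -OB; exact: xe.
Qed.

Section density_gives_full_content.
Context {R : realType} {A : pointedMetricType R} (dim : R)
  (mu : {measure set (borelType A) -> \bar R}) (D : set (set A)).
Hypothesis (hD : dyadic_decomposition D).

Lemma dyadic_ahlfors_bounds : @ahlfors_regular R A dim mu ->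
  exists C r0, @ahlfors_bounds R A dim mu C r0.
Proof.
move=> [C C1 reg].
have [a [K [rho1 [a1 K1 rho10 [cell atscale _ _]]]]] := dyadic_geometry hD.
have [Q [d [DQ Qx Qd drho _]]] := atscale point rho1 rho10 (lexx _).
have [x0 [d' [_ d'0 Qd' _]]] := cell Q DQ.
exists C, d'; split => // x r r0 rd'; apply: reg => //.
apply: (@lt_le_trans _ _ (diameter Q)); first by rewrite Qd' lte_fin.
apply: ge_ereal_sup => _ [->|[p [] Qp1 Qp2 <-]]; first exact: diameter_ge0.
by apply: ereal_sup_ubound; right; exists p.
Qed.

(** Every ball contains a cell of comparable diameter, and the cell contains a
    ball, whose content is bounded from below by the measure. *)
Lemma thick_of_dense_in_cells C r0 a K rho1 rho0 r (E : set A) c :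
  @ahlfors_bounds R A dim mu C r0 -> 1 <= a -> 1 <= K ->
  (forall Q, D Q -> exists x d,
       [/\ Q x, 0 < d, diameter Q = d%:E & ball x (d / a) `<=` Q]) ->
  (forall x rho, 0 < rho -> rho <= rho1 -> exists Q d,
       [/\ D Q, Q x, diameter Q = d%:E, d < rho & rho <= K * d]) ->
  rho0 <= rho1 -> rho0 <= r0 -> 0 < r -> r < dim -> 0 < c ->
  (forall Q, D Q ->
    (c%:E * hausdorff_content r Q <= hausdorff_content r (E `&` Q))%E) ->
  thick rho0 r E.
Proof.
move=> bnd a1 K1 cell atscale rho01 rho0r rgt rdim c0 dense.
case: (bnd) => C1 r00 _.
have C0 : 0 < C by exact: lt_le_trans C1.
have a0 : 0 < a by exact: lt_le_trans a1.
have K0 : 0 < K by exact: lt_le_trans K1.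
exists (c * (C ^- 2 * (K * a)^-1 `^ r)).
  by rewrite !mulr_gt0// ?powR_gt0 ?invr_gt0 ?exprn_gt0 ?mulr_gt0.
move=> x rho rhogt rhole.
have [Q [d [DQ Qx Qd drho rhoK]]] := atscale x rho rhogt (le_trans rhole rho01).
have [z [d' [Qz d'0 Qd' zQ]]] := cell Q DQ.
have {Qd'}dd' : d = d' by move: Qd'; rewrite Qd => -[].
subst d'.
have da0 : 0 < d / a by rewrite divr_gt0.
have dar : d / a < r0.
  apply: le_lt_trans (lt_le_trans drho (le_trans rhole rho0r)).
  by rewrite ler_pdivrMr// ler_peMr// ltW.
apply: (@le_trans _ _ (hausdorff_content r (E `&` Q))); last first.
  apply: hausdorff_content_mono => y [Ey Qy]; split => //.
  rewrite ballEmdist/=; apply: le_lt_trans drho.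
  by have /(width_leP _ (ltW d'0)) : (diameter Q <= d%:E)%E; [rewrite Qd|apply].
apply: le_trans (dense Q DQ).
rewrite -mulrA EFinM; apply: lee_wpmul2l; first by rewrite lee_fin ltW.
apply: le_trans (hausdorff_content_mono _ zQ).
apply: le_trans (content_ball_ge z bnd rgt rdim da0 dar).
rewrite lee_fin -mulrA ler_wpM2l ?invr_ge0 ?exprn_ge0 ?(ltW C0)//.
rewrite -powRM ?invr_ge0 ?mulr_ge0 ?(ltW K0) ?(ltW a0) ?(ltW rhogt)//.
rewrite ge0_ler_powR ?nnegrE ?(ltW rgt) ?(ltW da0)//.
  by rewrite mulr_ge0 ?invr_ge0 ?mulr_ge0 ?(ltW K0) ?(ltW a0) ?(ltW rhogt).
rewrite ler_pdivlMr// mulrC mulrA.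
have -> : a * (K * a)^-1 = K^-1 by field; rewrite !gt_eqF.
by rewrite ler_pdivrMl.
Qed.

Lemma full_content_of_dense s (Fs : set (set A)) :
  proper_metric A -> @ahlfors_regular R A dim mu ->
  0 < s -> s < dim -> (forall E, Fs E -> Gdelta E) ->
  (forall E, Fs E -> forall t : R, 0 <= t -> t < s ->
     exists2 c : R, 0 < c & forall Q, D Q ->
       (c%:E * hausdorff_content t Q <= hausdorff_content t (E `&` Q))%E) ->
  forall G : set (set A), countable G -> G `<=` Fs ->
    forall t, 0 < t -> t < s -> forall U : set A, open U ->
    hausdorff_content t ((\bigcap_(E in G) E) `&` U) = hausdorff_content t U.
Proof.
move=> hproper hreg s0 sdim gd dense G cG GFs t t0 ts U oU.
have [C [r0 bnd]] := dyadic_ahlfors_bounds hreg.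
have [a [K [rho1 [a1 K1 rho10 [cell atscale _ tb]]]]] := dyadic_geometry hD.
case: (bnd) => C1 r00 _.
pose delta := r0 / 4.
have delta0 : 0 < delta by rewrite divr_gt0.
have delta3 : 3 * delta < r0 by rewrite /delta; lra.
have [N [X nets]] := ahlfors_nets bnd tb delta0 delta3.
pose rho0 := Num.min rho1 r0.
have rho00 : 0 < rho0 by rewrite lt_min rho10.
have rho01 : rho0 <= rho1 by rewrite ge_min lexx.
have rho0r : rho0 <= r0 by rewrite ge_min lexx orbT.
have [e [eG ->]] := countable_bigcap_seq cG.
have [n|O [oO eO ->]] := @bigcap_Gdelta_open _ e.
  case: (eG n) => [/GFs/gd//|->]; exact/open_Gdelta/openT.
have thO j r : 0 < r -> r < s -> thick rho0 r (O j).
  move=> rgt rs; have [n /thick_mono] := eO j; apply.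
  have rdim := lt_trans rs sdim.
  have [c c0 cP] : exists2 c, 0 < c & forall Q, D Q ->
      (c%:E * hausdorff_content r Q <= hausdorff_content r (e n `&` Q))%E.
    case: (eG n) => [/GFs/dense/(_ r (ltW rgt) rs)//|->].
    by exists 1 => // Q _; rewrite mul1e setTI.
  exact: (thick_of_dense_in_cells bnd a1 K1 cell atscale rho01 rho0r rgt rdim c0 cP).
have cT : compact [set: A].
  by apply: proper_bounded_compact => //; exact: totally_bounded_bounded.
pose r := (t + s) / 2.
have tr : t < r by rewrite /r; lra.
have rs : r < s by rewrite /r; lra.
have thr := thick_bigcap rho00 delta0 nets cT oO thO (lt_trans t0 tr) rs.
exact: (thick_full_content rho00 delta0 nets t0 tr thr oU).
Qed.

End density_gives_full_content.

(** * Existence of Whitney decompositions *)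

(** A point-finite cover has an irreducible subcover: by Zorn's lemma there is a
    maximal family of members whose removal still leaves a cover.  The union of a
    chain of removable families is removable, because if it contained all the
    members through x, one family of the chain would contain these finitely many
    members. *)
Lemma irreducible_subcover (T : Type) (F : set (set T)) :
  (forall x, finite_set [set Q | F Q /\ Q x]) ->
  exists W : set (set T), [/\ W `<=` F,
    \bigcup_(Q in W) Q = \bigcup_(Q in F) Q &
    forall Q, W Q -> exists2 x, Q x & forall Q', W Q' -> Q' x -> Q' = Q].
Proof.
move=> Ffin; set U := \bigcup_(Q in F) Q.
pose removable (Z : set (set T)) := U `<=` \bigcup_(Q in F `\` Z) Q.
have [Ch Chrem Chtot|Z [Zrem Zmax]] := @Zorn_bigcup _ removable.
  move=> x Ux; apply: contrapT => nox.
  have sub Q : F Q -> Q x -> exists2 Z, Ch Z & Z Q.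
    by move=> FQ Qx; apply: contrapT => nZ; apply: nox; exists Q.
  have [Q0 FQ0 Q0x] := Ux.
  have [Z0 ChZ0 _] := sub Q0 FQ0 Q0x.
  have /finite_seqP[l lE] := Ffin x.
  have [Z ChZ lZ] : exists2 Z, Ch Z & forall Q, Q \in l -> Z Q.
    have : forall Q, Q \in l -> F Q /\ Q x.
      by move=> Q Ql; have : [set Q | F Q /\ Q x] Q by rewrite lE.
    elim: l {lE} => [_|Q l IH lF]; first by exists Z0.
    have [|Z ChZ lZ] := IH; first by move=> Q' Q'l; apply: lF; rewrite inE Q'l orbT.
    have [FQ Qx] := lF Q (mem_head _ _).
    have [Z1 ChZ1 Z1Q] := sub Q FQ Qx.
    have [ZZ1|Z1Z] := Chtot Z Z1 ChZ ChZ1.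
      exists Z1 => // Q'; rewrite inE => /orP[/eqP ->//|/lZ]; exact: ZZ1.
    exists Z => // Q'; rewrite inE => /orP[/eqP ->|/lZ//]; exact: Z1Z.
  have [Q [FQ nZQ] Qx] := Chrem Z ChZ x Ux.
  by apply/nZQ/lZ; have : [set Q | F Q /\ Q x] Q by []; rewrite lE.
exists (F `\` Z); split.
- by move=> Q [].
- apply/seteqP; split; last exact: Zrem.
  by move=> x [Q [FQ _] Qx]; exists Q.
- move=> Q [FQ nZQ].
  have /existsNP[x /not_implyP[Ux nox]] : ~ removable (Z `|` [set Q]).
    apply: Zmax; split; first by move=> Q'; left.
    by move=> /(_ Q) ZQ; apply/nZQ/ZQ; right.
  have only Q' : (F `\` Z) Q' -> Q' x -> Q' = Q.
    move=> [FQ' nZQ'] Q'x; apply: contrapT => Q'Q.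
    by apply: nox; exists Q' => //; split => // -[].
  have [Q1 WQ1 Q1x] := Zrem x Ux.
  by exists x => //; rewrite -(only Q1 WQ1 Q1x).
Qed.

Section whitney.
Context {R : realType} {A : pointedMetricType R}.

(** The number d is the distance from y to the complement of U; the second part
    replaces the attainment of the infimum. *)
Lemma exists_dist_to_compl (U : set A) y : open U -> U y -> (exists z, ~ U z) ->
  exists2 d : R, 0 < d & (forall z, ~ U z -> d <= mdist y z) /\
    (exists2 z, ~ U z & mdist y z < 2 * d).
Proof.
move=> oU Uy [z0 nUz0].
have /nbhs_ballP[e /= e0 eU] : nbhs y U by exact: open_nbhs_nbhs.
have far z : ~ U z -> e <= mdist y z.
  by move=> nUz; rewrite leNgt; apply/negP => yz; apply/nUz/eU; rewrite ballEmdist.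
pose S := [set mdist y z | z in ~` U].
have hS : has_inf S by split; [exists (mdist y z0), z0|exists e => _ [z /far ? <-]].
have eS : e <= inf S by apply: lb_le_inf; [case: hS|move=> _ [z /far ? <-]].
have S0 : 0 < inf S by exact: lt_le_trans eS.
exists (inf S) => //; split=> [z nUz|].
  by apply: ge_inf; [case: hS|exists z].
have [_ [z nUz <-] zS] := inf_adherent S0 hS.
by exists z => //; lra.
Qed.

Lemma frontier_compl (U : set A) p : open U -> frontier U p -> ~ U p.
Proof. by rewrite openE => oU [_ nUp] /oU. Qed.

(** The cells whose diameter is comparable to their distance to the complement of
    U are contained in U, cover U, and form a point-finite family; an irreducible
    subcover has the private points demanded of a Whitney decomposition.  The
    hypothesis on frontier points is essential in disconnected spaces, where the
    frontier may be much farther away than the complement, or empty. *)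
Lemma whitney_exists (D : set (set A)) (U : set A) :
  dyadic_decomposition D -> open U -> (exists z, ~ U z) ->
  (forall y z, U y -> ~ U z -> exists2 p, frontier U p & mdist y p <= mdist y z) ->
  exists W, whitney_decomposition D U W.
Proof.
move=> hD oU neU near_frontier.
have [a [K [rho1 [a1 K1 rho10 [cell atscale finD tb]]]]] := dyadic_geometry hD.
have [L0 L0P] := totally_bounded_bounded tb point.
pose L := 2 * L0 + 1.
have LP (y z : A) : mdist y z <= L.
  have := @metric_triangle _ A y point z; rewrite (metric_sym y point).
  by have := L0P y; have := L0P z; rewrite /L; lra.
have Lgt : 0 < L by have := L0P point; rewrite mdistxx /L; lra.
pose tau := Num.min 3^-1 (rho1 / L).
have tau0 : 0 < tau by rewrite lt_min invr_gt0 ltr0n divr_gt0.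
have tau3 : tau <= 3^-1 by rewrite ge_min lexx.
have tauL : tau * L <= rho1 by rewrite -ler_pdivlMr// ge_min lexx orbT.
pose M := 2 * K / tau.
have M1 : 1 < M.
  rewrite /M ltr_pdivlMr// mul1r; apply: le_lt_trans tau3 _.
  lra.
pose comparable_cell Q := D Q /\ exists d, [/\ diameter Q = d%:E, 0 < d,
  forall y z, Q y -> ~ U z -> 2 * d <= mdist y z &
  exists y z, [/\ Q y, ~ U z & mdist y z <= M * d]].
have coverU : \bigcup_(Q in comparable_cell) Q = U.
  apply/seteqP; split => [y [Q [_ [d [_ d0 sep _]]] Qy]|y Uy].
    apply: contrapT => nUy; have := sep y y Qy nUy.
    by rewrite mdistxx; lra.
  have [dlt dlt0 [far [z nUz zdlt]]] := exists_dist_to_compl oU Uy neU.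
  have rho0 : 0 < tau * dlt by rewrite mulr_gt0.
  have rhole : tau * dlt <= rho1.
    apply: le_trans tauL; rewrite ler_pM2l//.
    exact: le_trans (far z nUz) (LP y z).
  have [Q [d [DQ Qy Qd drho rhoK]]] := atscale y _ rho0 rhole.
  have [_ [d' [_ d0 Qd' _]]] := cell Q DQ.
  have {Qd'}E : d = d' by move: Qd'; rewrite Qd => -[].
  subst d'.
  exists Q => //; split => //; exists d; split => //.
    move=> y' z' Qy' nUz'.
    have : mdist y y' <= d.
      by have /(width_leP _ (ltW d0)) : (diameter Q <= d%:E)%E; [rewrite Qd|apply].
    have := far z' nUz'; have := metric_triangle y y' z'.
    have : tau * dlt <= 3^-1 * dlt by rewrite ler_wpM2r// ltW.
    lra.
  exists y, z; split => //; apply: le_trans (ltW zdlt) _.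
  rewrite /M mulrAC ler_pdivlMr//; move: rhoK.
  by rewrite -[_ * dlt * _]mulrA [dlt * _]mulrC -[2 * K * d]mulrA ler_pM2l.
have pointfinite x : finite_set [set Q | comparable_cell Q /\ Q x].
  have [Ux|nUx] := pselect (U x); last first.
    apply: (sub_finite_set _ (finite_set0 _)) => Q [cQ Qx].
    by apply: nUx; rewrite -coverU; exists Q.
  have [dlt dlt0 [far _]] := exists_dist_to_compl oU Ux neU.
  have M10 : 0 < 1 + M by lra.
  apply: (sub_finite_set _ (finD (dlt / (1 + M)) (divr_gt0 dlt0 M10))).
  move=> Q [[DQ [d [Qd d0 _ [y [z [Qy nUz yz]]]]]] Qx]; split => //.
  rewrite Qd lee_fin ler_pdivrMr// mulrDr mulr1.
  have : mdist x y <= d.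
    by have /(width_leP _ (ltW d0)) : (diameter Q <= d%:E)%E; [rewrite Qd|apply].
  by have := far z nUz; have := metric_triangle x y z; lra.
have [W [WF Wcov Wpriv]] := irreducible_subcover pointfinite.
exists W; split; [split => //|split => //].
- by apply/eqP => UT; case: neU => z; rewrite UT; apply.
- by move=> Q /WF[].
- by rewrite Wcov.
- exists 2, M; split => //; first by rewrite ltr1n.
  move=> Q WQ; have [DQ [d [Qd d0 sep [y [z [Qy nUz yz]]]]]] := WF Q WQ.
  rewrite Qd; apply/andP; split.
    rewrite lee_pdivlMl// -EFinM; apply: le_ereal_inf_tmp => _ /= [[u v] /= [Qu fv] <-].
    by rewrite lee_fin; apply: sep => //; exact: frontier_compl.
  rewrite lee_pdivrMl// -EFinM.
  have Uy : U y by rewrite -coverU; exists Q => //; exact: WF.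
  have [p fp yp] := near_frontier y z Uy nUz.
  apply: (@le_trans _ _ (mdist y p)%:E).
    by apply: ereal_inf_lbound; exists (y, p).
  rewrite lee_fin.
  have := mdist_ge0 y z; lra.
Qed.

End whitney.

(** * Punctured balls *)

Section punctured_ball.
Context {R : realType} {A : pointedMetricType R}.

Lemma hausdorff_content_seq0 t (s : seq A) : 0 < t ->
  hausdorff_content t [set z | z \in s] = 0%E.
Proof.
move=> t0; apply/eqP; rewrite eq_le hausdorff_content_ge0 andbT.
have := @hausdorff_content_seq R A t A s xpredT (fun z => [set z]).
rewrite (_ : mkset _ = [set z | z \in s]); last first.
  by apply/seteqP; split => [z [w [ws _ ->]]//|z zs]; exists z.
move=> /le_trans; apply; apply: sume_le0 => z _.
have := @content_le_pow R A t 0 [set z] t0 (lexx _).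
by rewrite powR0 ?gt_eqF//; apply => _ _ -> ->; rewrite mdistxx.
Qed.

Lemma dist_to_seq_gt0 (y : A) (s : seq A) :
  exists2 e : R, 0 < e & forall z, z \in s -> z != y -> e <= mdist y z.
Proof.
elim: s => [|z s [e e0 eP]]; first by exists 1.
have [->|zy] := eqVneq z y.
  by exists e => // w; rewrite inE => /orP[/eqP ->|]; [rewrite eqxx|exact: eP].
exists (Num.min e (mdist y z)); first by rewrite lt_min e0 mdist_gt0 eq_sym.
move=> w; rewrite inE => /orP[/eqP -> _|ws wy]; first by rewrite ge_min lexx orbT.
by rewrite ge_min eP.
Qed.

Lemma dyadic_nonisolated (D : set (set A)) (y : A) (e : R) :
  dyadic_decomposition D -> 0 < e -> exists2 z, z != y & mdist y z < e.
Proof.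
move=> hD e0.
have [a [K [rho1 [a1 K1 rho10 [cell atscale _ _]]]]] := dyadic_geometry hD.
have m0 : 0 < Num.min e rho1 by rewrite lt_min e0.
have m1 : Num.min e rho1 <= rho1 by rewrite ge_min lexx orbT.
have [Q [d [DQ Qy Qd dm _]]] := atscale y _ m0 m1.
have [_ [d' [_ d0 Qd' _]]] := cell Q DQ.
have {Qd'}E : d = d' by move: Qd'; rewrite Qd => -[].
subst d'.
have dQ : width_le d Q by apply/(width_leP _ (ltW d0)); rewrite Qd.
apply: contrapT => iso.
suff : (diameter Q <= 0%:E)%E by rewrite Qd lee_fin leNgt d0.
apply/(width_leP _ (lexx _)).
have Qy1 z : Q z -> z = y.
  move=> Qz; apply: contrapT => /eqP zy; apply: iso; exists z => //.
  apply: le_lt_trans (dQ _ _ Qy Qz) (lt_le_trans dm _).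
  by rewrite ge_min lexx.
by move=> u v /Qy1 -> /Qy1 ->; rewrite mdistxx.
Qed.

Context (delta : R) (N : nat) (X : nat -> seq A) (x0 : A) (rho : R).
Hypothesis delta0 : 0 < delta.
Hypothesis nets : bounded_nets delta N X.
Hypothesis (rho0 : 0 < rho) (rhod : rho <= delta).

Let rk k := delta / 2 ^+ k.

Let depth y := rho - mdist x0 y.

(** The points of the net of radius rk k whose depth in the ball is comparable to
    rk k: a discrete set in the ball that is dense at the scale of the depth. *)
Definition punctures := [set z | exists k, z \in X k /\
  rk k <= depth z <= 8 * rk k].

Let rk0 k : 0 < rk k.
Proof. by rewrite divr_gt0// exprn_gt0. Qed.

Let rkS k : rk k = 2 * rk k.+1.
Proof. by rewrite /rk exprS; field; rewrite gt_eqF// exprn_gt0. Qed.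

Let rk_anti m k : (m <= k)%N -> rk k <= rk m.
Proof.
move=> mk; rewrite -(subnKC mk); elim: (k - m)%N => [|i IH]; first by rewrite addn0.
by rewrite addnS; have := rkS (m + i); have := rk0 (m + i).+1; lra.
Qed.

Let depth_lip y z : depth z <= depth y + mdist y z.
Proof.
by rewrite /depth; have := metric_triangle x0 z y; rewrite (metric_sym z y); lra.
Qed.

Lemma punctures_sub z : punctures z -> 0 < depth z.
Proof. by move=> [k [_ /andP[/(lt_le_trans (rk0 k))]]]. Qed.

Lemma punctures_discrete y : 0 < depth y ->
  exists2 e, 0 < e & forall z, punctures z -> z != y -> e <= mdist y z.
Proof.
move=> gy; have [k0 kle] := @divr_exp2_small R delta (depth y / 16) (divr_gt0 gy (ltr0Sn _ _)).
have {}kle : rk k0 < depth y / 16 by [].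
have [e e0 eP] := dist_to_seq_gt0 y (flatten [seq X k | k <- iota 0 k0]).
exists (Num.min e (depth y / 2)); first by rewrite lt_min e0 divr_gt0.
move=> z [k [zX /andP[_ gz]]] zy; rewrite ge_min.
have [//|far] := leP (depth y / 2) (mdist y z); first by rewrite orbT.
rewrite eP//; apply/flattenP; exists (X k) => //; apply: map_f.
rewrite mem_iota /= add0n ltnNge; apply/negP => /rk_anti.
by have := depth_lip z y; rewrite (metric_sym z y); lra.
Qed.

Lemma punctures_near y : 0 < depth y ->
  exists2 p, punctures p & mdist y p <= depth y.
Proof.
move=> gy.
(* The first scale k at which 2 rk k is at most the depth also has
   depth < 4 rk k, so a net point within rk k of y has depth between rk k and
   5 rk k. *)
pose P k := 2 * rk k <= depth y.
have exP : exists k, P k.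
  have [k kle] := @divr_exp2_small R delta (depth y / 2) (divr_gt0 gy (ltr0Sn _ _)).
  by exists k; rewrite /P; have {kle} : rk k < depth y / 2 by []; lra.
case: (ex_minnP exP) => k Pk kmin.
have dk : depth y < 4 * rk k.
  case: k Pk kmin => [|k] Pk kmin.
    rewrite /P /rk expr0 divr1 in Pk *; have := mdist_ge0 x0 y.
    by move: rho0 rhod delta0 Pk; rewrite /depth; lra.
  rewrite ltNge; apply/negP => ge; suff : (k.+1 <= k)%N by rewrite ltnn.
  by apply: kmin; rewrite /P (rkS k); lra.
have [p pX yp] := nets.1 k y.
have {}yp : mdist y p < rk k by [].
have Pk' : 2 * rk k <= depth y by [].
exists p; last by have := rk0 k; lra.
exists k; split => //; apply/andP; split.
  by have := depth_lip p y; rewrite (metric_sym p y); lra.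
by have := depth_lip y p; lra.
Qed.

(** Removing the punctures makes every point of the ball about as close to the
    frontier as to the complement, since the punctures become frontier points;
    here one uses that the space has no isolated points.  The content is
    unchanged because a countable set has content 0 at positive exponents. *)
Lemma punctured_ball (D : set (set A)) : dyadic_decomposition D ->
  exists U : set A, [/\ open U, U `<=` ball x0 rho,
    exists W, whitney_decomposition D U W &
    forall r, 0 < r ->
      (hausdorff_content r (ball x0 rho) <= hausdorff_content r U)%E].
Proof.
move=> hD; pose U := ball x0 rho `\` punctures.
have depthP y : ball x0 rho y <-> 0 < depth y.
  by rewrite ballEmdist/= /depth subr_gt0.
have inU y e : 0 < depth y ->
    (forall z, punctures z -> z != y -> e <= mdist y z) ->
    forall z, z != y -> mdist y z < e -> mdist y z < depth y -> U z.
  move=> gy eP z zy ze zg; split.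
    by apply/depthP; have := depth_lip z y; rewrite (metric_sym z y); lra.
  by move=> /eP/(_ zy); rewrite leNgt ze.
have oU : open U.
  rewrite openE => y [/depthP gy nPy].
  have [e e0 eP] := punctures_discrete gy.
  apply/nbhs_ballP; exists (Num.min e (depth y)); first by rewrite /= lt_min e0.
  move=> z; rewrite ballEmdist/= lt_min => /andP[ze zg].
  have [->|zy] := eqVneq z y; first by split => //; apply/depthP.
  exact: (inU y e).
have nUP z : punctures z -> ~ U z by move=> Pz [_].
have frontierP p : punctures p -> frontier U p.
  move=> Pp; split; last by move=> /interior_subset; exact: nUP.
  move=> V /nbhs_ballP[e1 /= e10 e1V].
  have gp := punctures_sub Pp.
  have [e e0 eP] := punctures_discrete gp.
  have m0 : 0 < Num.min e1 (Num.min e (depth p)) by rewrite !lt_min e10 e0.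
  have [z zp] := dyadic_nonisolated p hD m0.
  rewrite !lt_min => /and3P[ze1 ze zg].
  by exists z; split; [exact: (inU p e)|apply: e1V; rewrite ballEmdist].
have gx0 : 0 < depth x0 by rewrite /depth mdistxx subr0.
exists U; split => //; first by move=> y [].
  apply: whitney_exists => //.
    by have [p Pp _] := punctures_near gx0; exists p; exact: nUP.
  move=> y z [/depthP gy nPy] nUz.
  have [Pz|nPz] := pselect (punctures z); first by exists z => //; exact: frontierP.
  have [p Pp yp] := punctures_near gy; exists p; first exact: frontierP.
  apply: le_trans yp _.
  have : ~ 0 < depth z by move=> /depthP zB; apply: nUz.
  by move=> /negP; rewrite -leNgt; have := depth_lip z y; rewrite (metric_sym z y); lra.
move=> r r0.
apply: (@le_trans _ _ (hausdorff_content r (U `|` \bigcup_k [set z | z \in X k]))).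
  apply: hausdorff_content_mono => y By.
  have [[k [yX _]]|nPy] := pselect (punctures y); first by right; exists k.
  by left.
apply: le_trans (hausdorff_contentU _ _ _) _.
apply: (@le_trans _ _ (hausdorff_content r U + 0)%E); last by rewrite adde0.
rewrite leeD2l//; apply: le_trans (hausdorff_content_bigcup _ _) _.
by rewrite eseries0// => k _ _; exact: hausdorff_content_seq0.
Qed.

End punctured_ball.

(** * From full content to density in the cells *)

Section rescaling.
Context {R : realType} {A : pointedMetricType R}.

(** Covering sets may be intersected with E, hence assumed to have diameter at
    most d. *)
Lemma content_change_exponent t r d (E Q : set A) :
  0 <= t -> t < r -> 0 < d -> diameter Q = d%:E -> E `<=` Q ->
  (hausdorff_content r E <= (d `^ (r - t))%:E * hausdorff_content t E)%E.
Proof.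
move=> t0 tr d0 Qd EQ.
have r0 : 0 < r by exact: le_lt_trans tr.
have dp0 : 0 < d `^ (r - t) by exact: powR_gt0.
rewrite -lee_pdivrMl//; apply: le_ereal_inf_tmp => _ [G /= EG <-].
rewrite lee_pdivrMl// -nneseriesZl => [|i _]; last exact: diam_pow_ge0.
apply: (@le_trans _ _ (\sum_(0 <= i <oo) diam_pow r (G i `&` E))%E).
  apply: ereal_inf_lbound; exists (fun i => G i `&` E) => //.
  by move=> x Ex; have [i _ Gx] := EG x Ex; exists i.
apply: lee_nneseries => i _; first by move=> _; exact: diam_pow_ge0.
have [GE0|/set0P[x [Gx Ex]]] := eqVneq (G i `&` E) set0.
  by rewrite GE0 diam_pow0 mule_ge0 ?diam_pow_ge0// lee_fin ltW.
rewrite diam_pow_pos// /diam_pow ifF; last by apply/negbTE/set0P; exists x.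
have leE (F1 F2 : set A) : F1 `<=` F2 -> (diameter F1 <= diameter F2)%E.
  move=> F12; apply: ereal_sup_le => _ [->|[[u v] [/= Fu Fv] <-]]; [by left|right].
  by exists (u, v) => //; split; exact: F12.
have := leE _ _ (@subIsetl _ (G i) E).
have : (diameter (G i `&` E) <= d%:E)%E.
  by rewrite -Qd; apply: leE => z [_ /EQ].
have := diameter_ge0 (G i `&` E); have := diameter_ge0 (G i).
case: (diameter (G i `&` E)) => [e| |]//; rewrite !lee_fin => gi0 e0 ed eg.
have pw : e `^ r = e `^ (r - t) * e `^ t.
  by rewrite -powRD ?subrK// gt_eqF.
have rt0 : 0 <= r - t by rewrite subr_ge0 ltW.
rewrite poweR_EFin pw EFinM; apply: lee_pmul; rewrite ?lee_fin ?powR_ge0//.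
  by rewrite ge0_ler_powR// nnegrE ltW.
rewrite -poweR_EFin; apply: gt0_ler_poweR; rewrite // in_itv/= ?leey ?lee_fin ?e0//.
by rewrite gi0.
Qed.

Lemma powR_near (x t : R) : 0 < x -> exists2 e : R, 0 < e &
  forall r, t < r -> r < t + e -> x `^ t / 2 <= x `^ r <= 2 * x `^ t.
Proof.
move=> x0.
have cont : (x `^ r) @[r --> t] --> x `^ t.
  rewrite /powR gt_eqF//; apply: (@cvg_comp _ _ _ (fun r => r * ln x) expR _ (nbhs (t * ln x))).
    by apply: cvgMr_tmp; exact: cvg_id.
  exact: continuous_expR.
have p0 : 0 < x `^ t / 2 by rewrite divr_gt0// powR_gt0.
move/cvgrPdist_le : cont => /(_ _ p0)/nbhs_ballP[e /= e0 eP].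
exists e => // r tr re; have := eP r; rewrite /ball/= ltr_norml => /(_ _).
have -> : - e < t - r < e by lra.
by move=> /(_ isT); rewrite ler_norml; lra.
Qed.

End rescaling.

Section full_content_gives_density.
Context {R : realType} {A : pointedMetricType R} (dim : R)
  (mu : {measure set (borelType A) -> \bar R}) (D : set (set A)).
Hypothesis (hD : dyadic_decomposition D).

(** The comparison takes place at an exponent t' strictly between t and s, on a
    punctured ball U inside Q of radius theta diam(Q).  The factor theta bounds
    the radius both by diam(Q)/a, so that U lies in Q, and by delta, the range of
    validity of the regularity bounds. *)
Lemma dense_of_full_content_hat s t (E : set A) :
  @ahlfors_regular R A dim mu -> s < dim -> 0 <= t -> t < s ->
  (forall t, 0 < t -> t < s -> forall U : set A, open U ->
     (exists W, whitney_decomposition D U W) ->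
     hausdorff_content_hat t (E `&` U) = hausdorff_content_hat t U) ->
  exists2 c : R, 0 < c & forall Q, D Q ->
    (c%:E * hausdorff_content t Q <= hausdorff_content t (E `&` Q))%E.
Proof.
move=> hreg sdim t0 ts full.
have [C [r0 bnd]] := dyadic_ahlfors_bounds hD hreg.
have [a [K [rho1 [a1 K1 rho10 [cell atscale _ tb]]]]] := dyadic_geometry hD.
case: (bnd) => C1 r00 _.
have C0 : 0 < C by exact: lt_le_trans C1.
have a0 : 0 < a by exact: lt_le_trans a1.
pose delta := r0 / 4.
have delta0 : 0 < delta by rewrite divr_gt0.
have delta3 : 3 * delta < r0 by rewrite /delta; lra.
have [N [X nets]] := ahlfors_nets bnd tb delta0 delta3.
have [L0 L0P] := totally_bounded_bounded tb point.
pose L := 2 * L0 + 1.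
have Lgt : 0 < L by have := L0P point; rewrite mdistxx /L; lra.
have LP (F : set A) : width_le L F.
  move=> y z _ _; have := @metric_triangle _ A y point z; rewrite (metric_sym y point).
  by have := L0P y; have := L0P z; rewrite /L; lra.
pose theta := Num.min a^-1 (delta / L).
have theta0 : 0 < theta by rewrite lt_min invr_gt0 a0 divr_gt0.
pose t' := (t + s) / 2.
have tt' : t < t' by rewrite /t'; lra.
have t's : t' < s by rewrite /t'; lra.
have t'0 : 0 < t' by exact: le_lt_trans tt'.
pose c := C ^- 2 * theta `^ t' / 4.
have c0 : 0 < c by rewrite divr_gt0// mulr_gt0 ?powR_gt0// invr_gt0 exprn_gt0.
exists c => // Q DQ.
have [x [d [Qx d0 Qd xQ]]] := cell Q DQ.
pose rho := theta * d.
have rho0 : 0 < rho by exact: mulr_gt0.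
have rhoa : rho <= d / a.
  by rewrite /rho mulrC ler_pM2l// ge_min lexx.
have rhod : rho <= delta.
  have dL : d <= L.
    have : (diameter Q <= L%:E)%E by apply/(width_leP _ (ltW Lgt)).
    by rewrite Qd lee_fin.
  apply: (@le_trans _ _ (delta / L * d)).
    by rewrite ler_pM2r// ge_min lexx orbT.
  by rewrite mulrAC ler_pdivrMr// ler_pM2l.
have rhor : rho < r0 by lra.
have [U [oU Usub UW Ucont]] := punctured_ball x delta0 nets rho0 rhod hD.
have UQ : U `<=` Q.
  move=> y /Usub; rewrite ballEmdist/= => xy; apply: xQ; rewrite ballEmdist/=.
  exact: lt_le_trans rhoa.
have [e1 e10 e1P] := powR_near t' rho0.
have [e2 e20 e2P] := powR_near (t' - t) d0.
(* On (t', u) the powers of rho and of d differ from those at t' by a factor of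
   at most 2, although rho and d themselves are not bounded below. *)
pose u := Num.min s (Num.min (t' + e1) (t' + e2)).
have t'u : t' < u by rewrite !lt_min t's !ltrDl e10.
have lower : ((C ^- 2 * (rho `^ t' / 2))%:E <= hausdorff_content_hat t' U)%E.
  apply: (content_hat_ge_bound t'u) => r t'r; rewrite !lt_min => /and3P[rs re1 _].
  apply: le_trans (Ucont r (lt_trans t'0 t'r)).
  apply: le_trans (content_ball_ge x bnd (lt_trans t'0 t'r) (lt_trans rs sdim) rho0 rhor).
  rewrite lee_fin ler_wpM2l ?invr_ge0 ?exprn_ge0 ?(ltW C0)//.
  by case/andP: (e1P r t'r re1).
have upper : (hausdorff_content_hat t' (E `&` U) <=
    (2 * d `^ (t' - t))%:E * hausdorff_content t (E `&` Q))%E.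
  apply: (content_hat_le_bound t'u) => r t'r; rewrite !lt_min => /and3P[_ _ re2].
  apply: (@le_trans _ _ (hausdorff_content r (E `&` Q))).
    by apply: hausdorff_content_mono => y [Ey /UQ].
  apply: le_trans (content_change_exponent t0 (lt_trans tt' t'r) d0 Qd (@subIsetr _ E Q)) _.
  rewrite lee_wpmul2r ?hausdorff_content_ge0// lee_fin.
  have r1 : t' - t < r - t by rewrite ltrD2r.
  have r2 : r - t < t' - t + e2 by lra.
  by case/andP: (e2P _ r1 r2).
have := le_trans lower (le_trans _ upper).
rewrite (full t' t'0 t's U oU UW) lexx => /(_ isT).
have dp0 : 0 < d `^ (t' - t) by exact: powR_gt0.
have k0 : 0 < 2 * d `^ (t' - t) by exact: mulr_gt0.
rewrite -lee_pdivrMl//; apply: le_trans.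
apply: (@le_trans _ _ (c%:E * (d `^ t)%:E)%E).
  apply: lee_wpmul2l; first by rewrite lee_fin ltW.
  apply: le_trans (content_le_diam_pow _ _) _.
  rewrite /diam_pow; case: ifP => _; first by rewrite lee_fin powR_ge0.
  by rewrite Qd poweR_EFin.
rewrite -!EFinM lee_fin /c /rho powRM ?(ltW theta0) ?(ltW d0)//.
have -> : d `^ t' = d `^ (t' - t) * d `^ t.
  by rewrite -powRD ?subrK// gt_eqF.
rewrite le_eqVlt; apply/orP; left; apply/eqP; field.
by rewrite !gt_eqF.
Qed.

End full_content_gives_density.

(** * The equivalence *)

Unset Implicit Arguments.

Theorem theorem3p13 (R : realType) (A : pointedMetricType R)
    (dim : R) (mu : {measure set (borelType A) -> \bar R})
    (hproper : proper_metric A)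
    (hreg : @ahlfors_regular R A dim mu)
    (D : set (set A)) (hD : dyadic_decomposition D)
    (s : R) (hs0 : 0 < s) (hsD : s < dim)
    (Fs : set (set A)) (hFs : forall E, Fs E -> Gdelta E) :
  (forall E, Fs E -> forall t : R, 0 <= t -> t < s ->
     exists2 c : R, 0 < c & forall Q, D Q ->
       (c%:E * hausdorff_content t Q <= hausdorff_content t (E `&` Q))%E)
  <->
  (forall G : set (set A), countable G -> G `<=` Fs ->
     forall t : R, 0 < t -> t < s ->
     forall U : set A, open U -> (exists W, whitney_decomposition D U W) ->
       hausdorff_content_hat t ((\bigcap_(E in G) E) `&` U) =
       hausdorff_content_hat t U).
Proof.
split=> [dense G cG GFs t t0 ts U oU _|full E FE t t0 ts].
  apply: (content_hat_eq ts) => r tr rs.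
  exact: (full_content_of_dense hD hproper hreg hs0 hsD hFs dense cG GFs
    (lt_trans t0 tr) rs oU).
apply: (dense_of_full_content_hat hD hreg hsD t0 ts) => r r0 rs U oU UW.
have := full [set E] (countable1 E) _ r r0 rs U oU UW.
by rewrite bigcap_set1; apply => _ ->.
Qed.
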